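(* Let $N,M\ge 1$, fix $\mu\in\mathbb R^M$ and $r\in\mathbb R$, and consider the nonautonomous system $$\dot x=f(x-\Lambda(rt),t,\mu,r),\qquad x\in\mathbb R^N,\tag{S}$$ where $\Lambda(rt)=(\Lambda_1(rt),\dots,\Lambda_N(rt))$, $\Lambda_i(rt)=a_i\lambda(rt)$ with constants $a_i\in\mathbb R$ and a scalar function $\lambda$, and $f$ and $\lambda$ are continuously differentiable. Suppose that (i) $t\mapsto\lambda(rt)$ is locally bounded (bounded on every finite time interval) for all $r$; (ii) there are a set $\mathcal N\subseteq\{1,\dots,N\}$ and constants $\alpha_i,b_i\in\mathbb R$ ($i\in\mathcal N$) such that the time-dependent vector $v(t)\in\mathbb R^N$ has components $v_i(t)=\alpha_i\lambda(rt)+b_i$ for $i\in\mathcal N$ and $v_j(t)=0$ for $j\notin\mathcal N$; (iii) the change of variables $y=x-v(t)$ transforms (S) into an autonomous system $$\dot y=g(y,\mu,r)=f(y+v(t)-\Lambda(rt),t,\mu,r)-\dot v(t),\qquad y\in\mathbb R^N,$$ i.e. the right-hand side does not depend on $t$. Then every hyperbolic equilibrium $y_r^*$ of $\dot y=g(y,\mu,r)$ corresponds to a globally defined solution of (S), namely $x^*(t)=y_r^*+v(t)$, $t\in\mathbb R$. Furthermore: (a) $y_r^*$ is a sink if and only if the corresponding globally defined solution $x^*$ of (S) is a (local) forward attracting pullback attractor; (b) $y_r^*$ is a source if and only if the corresponding globally defined solution $x^*$ of (S) is a (local) forward repelling pullback repeller.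
   Context: An equilibrium $y_r^*$ is hyperbolic if the linearization $D_yg(y_r^*,\mu,r)$ has no eigenvalue on the imaginary axis; it is a sink (source) if all eigenvalues have negative (positive) real part. A globally defined solution is a solution existing for all $t\in\mathbb R$. Let $x(t;x_0,t_0)$ denote the solution of (S) with $x(t_0;x_0,t_0)=x_0$. For a globally defined solution $\gamma:\mathbb R\to\mathbb R^N$ of (S) (all notions are local, and the existence of the solutions on the time intervals involved is part of each definition): - $\gamma$ is forward attracting if there is $\delta>0$ such that for every $\xi\in\mathbb R^N$ with $|\xi|<\delta$ and every $t_0\in\mathbb R$, $\lim_{s\to\infty}|x(s;\gamma(t_0)+\xi,t_0)-\gamma(s)|=0$. - $\gamma$ is a pullback attractor if there is $\delta>0$ such that for every $\xi\in\mathbb R^N$ with $|\xi|<\delta$ and every $t\in\mathbb R$, $\lim_{s\to-\infty}|x(t;\gamma(s)+\xi,s)-\gamma(t)|=0$. - $\gamma$ is forward repelling, respectively a pullback repeller, if it is forward attracting, respectively a pullback attractor, for the time-reversed system; that is, there is $\delta>0$ such that for every $|\xi|<\delta$ one has $\lim_{s\to-\infty}|x(s;\gamma(t_0)+\xi,t_0)-\gamma(s)|=0$ for every $t_0\in\mathbb R$, respectively $\lim_{s\to\infty}|x(t;\gamma(s)+\xi,s)-\gamma(t)|=0$ for every $t\in\mathbb R$. A ''forward attracting pullback attractor'' is a solution that is both forward attracting and a pullback attractor; a ''forward repelling pullback repeller'' is both forward repelling and a pullback repeller. *)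

(* Defs.v *)
From HB Require Import structures.
From mathcomp Require Export all_boot all_order all_algebra.
From mathcomp Require Export all_classical all_reals all_analysis.
From mathcomp Require Export complex.
Export numFieldNormedType.Exports.

Set Implicit Arguments.
Unset Strict Implicit.
Unset Printing Implicit Defensive.

Import Order.TTheory GRing.Theory Num.Theory.

Local Open Scope classical_set_scope.
Local Open Scope ring_scope.

(* The library topologizes ['rV[R]_n] by the max norm; it is equivalent to the
   Euclidean norm, and the notions below do not depend on the choice. *)

(* Continuity of the derivative is with respect to the operator norm. *)
Definition continuously_differentiable (R : realType) (E V : normedModType R)
    (f : E -> V) : Prop :=
  (forall p : E, differentiable f p) /\
  (forall (p : E) (e : R), 0 < e ->
     \forall q \near p, forall h : E, `|'d f q h - 'd f p h| <= e * `|h|).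

Section Equilibria.
Context {R : realType} {N : nat}.
Implicit Types (G : 'rV[R]_N -> 'rV[R]_N) (y : 'rV[R]_N).

(* [jacobian] is the transpose of the usual Jacobian matrix (it acts on row
   vectors from the right), which does not change the spectrum. *)
Definition linearization_eigenvalue G y (z : R[i]) : Prop :=
  eigenvalue (map_mx (real_complex R) (jacobian G y)) z.

Definition equilibrium G y : Prop := G y = 0.

Definition hyperbolic_equilibrium G y : Prop :=
  equilibrium G y /\
  forall z, linearization_eigenvalue G y z -> complex.Re z != 0.

Definition sink G y : Prop :=
  equilibrium G y /\
  forall z, linearization_eigenvalue G y z -> complex.Re z < 0.

Definition source G y : Prop :=
  equilibrium G y /\
  forall z, linearization_eigenvalue G y z -> 0 < complex.Re z.

End Equilibria.

Section NonautonomousSystems.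
Context {R : realType} {N : nat}.
(* [F x t] is the right-hand side of x' = F(x, t). *)
Implicit Types (F : 'rV[R]_N -> R -> 'rV[R]_N) (gamma x : R -> 'rV[R]_N).

(* Only the values of [x] on the interval [I] matter. For continuous [F] the
   equation then also holds, with one-sided derivatives, at the endpoints. *)
Definition solution_on F (I : set R) x : Prop :=
  {within I, continuous x} /\
  forall t, I° t -> is_derive t (1 : R) x (F (x t) t).

Definition global_solution F gamma : Prop := solution_on F setT gamma.

Definition ivp_solution_on F (I : set R) (t0 : R) (x0 : 'rV[R]_N) x : Prop :=
  solution_on F I x /\ x t0 = x0.

(* In the following four definitions the existentially quantified functions
   stand for x(.; x0, t0) on the time interval involved: the existential asserts
   existence there, and uniqueness holds since the systems considered have C^1
   right-hand sides. In the two pullback notions, [x s] is the solution started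
   at time [s]. *)

Definition forward_attracting F gamma : Prop :=
  exists2 delta : R, 0 < delta &
    forall xi : 'rV[R]_N, `|xi| < delta -> forall t0 : R,
      exists2 x : R -> 'rV[R]_N,
        ivp_solution_on F `[t0, +oo[ t0 (gamma t0 + xi) x &
        `|x s - gamma s| @[s --> +oo] --> (0 : R).

Definition pullback_attractor F gamma : Prop :=
  exists2 delta : R, 0 < delta &
    forall xi : 'rV[R]_N, `|xi| < delta -> forall t : R,
      exists2 x : R -> R -> 'rV[R]_N,
        (forall s, s <= t -> ivp_solution_on F `[s, t] s (gamma s + xi) (x s)) &
        `|x s t - gamma t| @[s --> -oo] --> (0 : R).

Definition forward_repelling F gamma : Prop :=
  exists2 delta : R, 0 < delta &
    forall xi : 'rV[R]_N, `|xi| < delta -> forall t0 : R,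
      exists2 x : R -> 'rV[R]_N,
        ivp_solution_on F `]-oo, t0] t0 (gamma t0 + xi) x &
        `|x s - gamma s| @[s --> -oo] --> (0 : R).

Definition pullback_repeller F gamma : Prop :=
  exists2 delta : R, 0 < delta &
    forall xi : 'rV[R]_N, `|xi| < delta -> forall t : R,
      exists2 x : R -> R -> 'rV[R]_N,
        (forall s, t <= s -> ivp_solution_on F `[t, s] s (gamma s + xi) (x s)) &
        `|x s t - gamma t| @[s --> +oo] --> (0 : R).

End NonautonomousSystems.

Definition Lambda (R : realType) (N : nat) (a : 'I_N -> R) (lambda : R -> R)
    (s : R) : 'rV[R]_N :=
  \row_i (a i * lambda s).

Definition system_S (R : realType) (N M : nat)
    (f : 'rV[R]_N * R * 'rV[R]_M * R -> 'rV[R]_N) (a : 'I_N -> R)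
    (lambda : R -> R) (mu : 'rV[R]_M) (r : R)
    (x : 'rV[R]_N) (t : R) : 'rV[R]_N :=
  f (x - Lambda a lambda (r * t), t, mu, r).

(* Main.v *)
(* In the frame moving with [v] the system is the autonomous one, so both parts
   reduce to an autonomous C^1 field [G] with a hyperbolic equilibrium [y]; part
   (b) is part (a) for the reversed field [- G].

   A Schur triangularization of the linearization, with geometrically growing
   weights absorbing the off-diagonal terms, gives a quadratic form [P] that
   grows along the linear flow at a rate bounded below by the squared norm, and
   that is negative definite when [y] is a sink. In that case [- P] is a Lyapunov
   function, and solutions starting near [y] converge exponentially to [y].

   Conversely, local attraction does not a priori exclude trajectories that leave
   a neighbourhood of [y] before returning to it. Let [E n] be the set of initial
   points whose trajectory remains close to [y] from time [n] on. These closed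
   sets cover a ball around [y], so by Baire some [E n] contains an open set [U].
   The time-[n] map sends [U] onto a neighbourhood of each of its image points,
   and on the difference of two trajectories that stay close to [y] forever [P]
   must be nonpositive, since otherwise it would grow exponentially. Hence [P] is
   nonpositive everywhere, and evaluating it on the real and imaginary parts of
   an eigenvector shows that every eigenvalue has negative real part. *)

From HB Require Import structures.
Require Import Defs.
From mathcomp Require Import spectral ring lra.

Set Implicit Arguments.
Unset Strict Implicit.
Unset Printing Implicit Defensive.

Import Order.TTheory GRing.Theory Num.Theory.

Local Open Scope classical_set_scope.
Local Open Scope ring_scope.

(** * Coordinate bounds for the max norm and for bilinear forms *)

Section RowVectorNorm.
Context {R : realType} {N : nat}.
Implicit Types u w : 'rV[R]_N.

Lemma row_coord_le_norm u i : `|u 0 i| <= `|u|.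
Proof.
rewrite [leRHS]/Num.Def.normr/= mx_normrE.
exact: (le_bigmax _ (fun ij => `|u ij.1 ij.2|) (0, i)).
Qed.

Lemma row_norm_le u (e : R) : 0 <= e -> (forall i, `|u 0 i| <= e) -> `|u| <= e.
Proof.
move=> e0 ue; rewrite [leLHS]/Num.Def.normr/= mx_normrE.
by apply: bigmax_le => // -[i j] _ /=; rewrite ord1.
Qed.

End RowVectorNorm.

Lemma mulmx_norm_le (R : realType) N p (A : 'M[R]_(N, p)) (u : 'rV[R]_N) :
  `|u *m A| <= (\sum_i \sum_j `|A i j|) * `|u|.
Proof.
apply: row_norm_le => [|j].
  by rewrite mulr_ge0// sumr_ge0// => i _; rewrite sumr_ge0.
rewrite mxE (le_trans (ler_norm_sum _ _ _))// mulr_suml ler_sum// => i _.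
rewrite normrM mulrC ler_pM// ?row_coord_le_norm//.
by rewrite (bigD1 j)//= lerDl sumr_ge0.
Qed.

Section BilinearForm.
Context {R : realType} {N : nat}.
Implicit Types (P A : 'M[R]_N) (u w : 'rV[R]_N).

Definition bform P u w : R := (u *m P *m w^T) 0 0.

Lemma bformDr P u w w' : bform P u (w + w') = bform P u w + bform P u w'.
Proof. by rewrite /bform linearD mulmxDr mxE. Qed.

Lemma bformZl P (k : R) u w : bform P (k *: u) w = k * bform P u w.
Proof. by rewrite /bform -!scalemxAl mxE. Qed.

Lemma bformZr P (k : R) u w : bform P u (k *: w) = k * bform P u w.
Proof. by rewrite /bform linearZ/= -scalemxAr mxE. Qed.

Lemma bformNr P u w : bform P u (- w) = - bform P u w.
Proof. by rewrite -scaleN1r bformZr mulN1r. Qed.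

Lemma bformNm P u w : bform (- P) u w = - bform P u w.
Proof. by rewrite /bform mulmxN mulNmx mxE. Qed.

Lemma bform_sym P u w : P^T = P -> bform P u w = bform P w u.
Proof.
move=> PT; have <- : (u *m P *m w^T)^T 0 0 = bform P u w by rewrite mxE.
by rewrite trmx_mul trmxK trmx_mul PT mulmxA.
Qed.

Lemma bformE P u w : bform P u w = \sum_i \sum_j u 0 i * P i j * w 0 j.
Proof.
rewrite /bform mxE exchange_big; apply: eq_bigr => j _.
by rewrite !mxE mulr_suml.
Qed.

Lemma bform_norm_le P u w :
  `|bform P u w| <= (\sum_i \sum_j `|P i j|) * `|u| * `|w|.
Proof.
rewrite bformE (le_trans (ler_norm_sum _ _ _))// !mulr_suml ler_sum// => i _.
rewrite (le_trans (ler_norm_sum _ _ _))// !mulr_suml ler_sum// => j _.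
rewrite !normrM [X in X * _]mulrC ler_pM//.
  by rewrite ler_pM// row_coord_le_norm.
exact: row_coord_le_norm.
Qed.

End BilinearForm.

(** * Quadratic Lyapunov forms for hyperbolic matrices *)

Section LyapunovForm.
Context {R : realType}.
Implicit Types z w : R[i].

(** The real inner product on the complex plane, that is, the real part of [z] times the conjugate
    of [w]. *)
Definition cdot z w : R :=
  complex.Re z * complex.Re w + complex.Im z * complex.Im w.

Let cdot_sumr z n (F : 'I_n -> R[i]) :
  cdot z (\sum_i F i) = \sum_i cdot z (F i).
Proof.
apply: (big_morph (cdot z)) => [[a b] [c d]|]; rewrite /cdot/=; last ring.
by ring.
Qed.

Let Re_sum n (F : 'I_n -> R[i]) :
  complex.Re (\sum_i F i) = \sum_i complex.Re (F i).
Proof. by apply: (big_morph (@complex.Re R)) => [[? ?] [? ?]|]. Qed.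

Let Im_sum n (F : 'I_n -> R[i]) :
  complex.Im (\sum_i F i) = \sum_i complex.Im (F i).
Proof. by apply: (big_morph (@complex.Im R)) => [[? ?] [? ?]|]. Qed.

Let cdot_mulr z w : cdot z (z * w) = complex.Re w * cdot z z.
Proof. by case: z w => a b [c d]; rewrite /cdot/=; ring. Qed.

Let cdot_ge0 z : 0 <= cdot z z.
Proof. by rewrite /cdot -!expr2 addr_ge0 ?sqr_ge0. Qed.

(** Young's inequality with parameter [e], obtained by completing the square separately for the real
    and the imaginary part of [z]. *)
Let cdot_mul_le z w t (e : R) : 0 < e ->
  `|cdot z (w * t)| <= e * cdot z z + cdot t t / (4 * e) * cdot w w.
Proof.
case: z w t => a b [c d] [x y] e0; rewrite /cdot/=.
have e4 : (4 * e) * (4 * e)^-1 = 1 by rewrite divff// mulf_neq0// gt_eqF.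
set q := (4 * e)^-1 in e4 *.
have q0 : 0 < q by rewrite invr_gt0 mulr_gt0.
set X := c * x - d * y; set Y := c * y + d * x.
have -> : (x * x + y * y) * q * (c * c + d * d) = q * (X ^+ 2 + Y ^+ 2).
  by rewrite /X /Y; ring.
have sq (p r : R) : 0 <= e * (p * p) + q * r ^+ 2 - p * r.
  have -> : e * (p * p) + q * r ^+ 2 - p * r = q * (r - 2 * e * p) ^+ 2.
    have -> : q * (r - 2 * e * p) ^+ 2
       = q * r ^+ 2 + (4 * e * q) * (e * (p * p)) - (4 * e * q) * (p * r) by ring.
    by rewrite e4; ring.
  by rewrite mulr_ge0 ?sqr_ge0// ltW.
rewrite ler_norml; apply/andP; split.
  by have := sq (- a) X; have := sq (- b) Y; lra.
by have := sq a X; have := sq b Y; lra.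
Qed.

Let pos_lower_bound n (F : 'I_n -> R) : (forall i, 0 < F i) ->
  exists2 r : R, 0 < r & forall i, r <= F i.
Proof.
move=> F0; exists (\big[Order.min/1]_i F i); last by move=> i; exact: bigmin_le.
by elim/big_ind : _ => // x y x0 y0; rewrite lt_min x0.
Qed.

(** [T] is lower triangular and acts from the right, so coordinate [j] of [w *m T] involves only the
    [w 0 i] with [i >= j]. The weight [c j] carries the sign of the real part of [T j j], which
    makes every diagonal contribution positive, and a size growing with [j], which lets later
    coordinates pay for the off-diagonal entries. The bound [c j <= -1] is what later makes the form
    negative definite for a sink. *)
Lemma trig_mx_form_coercive n (T : 'M[R[i]]_n) : (0 < n)%N -> is_trig_mx T ->
  (forall j, complex.Re (T j j) != 0) ->
  exists (c : 'I_n -> R) (r : R),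
    [/\ 0 < r, forall j, complex.Re (T j j) < 0 -> c j <= -1 &
      forall w : 'rV[R[i]]_n,
        r * (\sum_j cdot (w 0 j) (w 0 j)) <=
        \sum_j c j * cdot (w 0 j) ((w *m T) 0 j)].
Proof.
move=> n0 /is_trig_mxP Ttrig T0.
have nr0 : 0 < n%:R :> R by rewrite ltr0n.
have [r r0 rT] : exists2 r : R, 0 < r & forall j, r <= `|complex.Re (T j j)|.
  by apply: pos_lower_bound => j; rewrite normr_gt0.
pose e := r / (2 * n%:R).
have e0 : 0 < e by rewrite divr_gt0// mulr_gt0.
pose t := \sum_i \sum_j cdot (T i j) (T i j) / (4 * e).
have tT i j : cdot (T i j) (T i j) / (4 * e) <= t.
  rewrite /t (bigD1 i)//= (bigD1 j)//= -addrA lerDl addr_ge0//.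
    by rewrite sumr_ge0// => k _; rewrite divr_ge0// ltW// mulr_gt0.
  by do 2 (rewrite sumr_ge0// => ? _); rewrite divr_ge0// ltW// mulr_gt0.
have t0 : 0 <= t.
  by do 2 (rewrite sumr_ge0// => ? _); rewrite divr_ge0// ltW// mulr_gt0.
pose K := 1 + 4 * n%:R * t / r.
have K1 : 1 <= K by rewrite /K lerDl divr_ge0// ?(ltW r0)// !mulr_ge0.
have K0 : 0 < K by exact: lt_le_trans K1.
(* The factor [K] gained at each row absorbs the off-diagonal entries of [T]. *)
pose k (j : 'I_n) : R := K ^+ j.
have k1 j : 1 <= k j by exact: exprn_ege1.
have k0 j : 0 < k j by exact: exprn_gt0.
have kt (i j : 'I_n) : (j < i)%N -> k j * t <= r / (4 * n%:R) * k i.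
  move=> ji; have Kt : t <= r / (4 * n%:R) * K.
    rewrite /K mulrDr; have -> : r / (4 * n%:R) * (4 * n%:R * t / r) = t.
      by field; rewrite !gt_eqF.
    by rewrite lerDr mulr1 divr_ge0// ?(ltW r0)// mulr_ge0.
  have kji : k j * K <= k i by rewrite /k -exprSr ler_weXn2l.
  apply: le_trans (ler_wpM2l (ltW (k0 j)) Kt) _.
  rewrite mulrCA ler_wpM2l// divr_ge0// ?(ltW r0)// mulr_ge0//.
pose c j := Num.sg (complex.Re (T j j)) * k j.
exists c, (r / 4); split => [|j Tj|w]; first by rewrite divr_gt0.
  by rewrite /c ltr0_sg// mulN1r lerN2.
pose m j := k j * cdot (w 0 j) (w 0 j).
have m0 j : 0 <= m j by rewrite mulr_ge0// ltW.
have cN j x : - (k j * `|x|) <= c j * x.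
  rewrite lerNl (le_trans (ler_norm _))// normrN /c !normrM normr_sg T0 mul1r.
  by rewrite (gtr0_norm (k0 j)).
(* Each pair [i], [j] is charged [e * m j] and [r / (4 * n%:R) * m i]. Summed over all pairs, the
   charges take [r / 2] and [r / 4] out of the diagonal gain [r], which leaves [r / 4]. *)
have main i j : (i == j)%:R * (r * m j) - e * m j - r / (4 * n%:R) * m i
    <= c j * cdot (w 0 j) (w 0 i * T i j).
  have em x : 0 <= e * m x by rewrite mulr_ge0// ltW.
  have rm x : 0 <= r / (4 * n%:R) * m x.
    by rewrite mulr_ge0// divr_ge0// ?(ltW r0)// mulr_ge0.
  have [->|ij] := eqVneq i j.
    rewrite mul1r cdot_mulr /c [leRHS]mulrA -[Num.sg _ * _ * _]mulrAC.
    rewrite -normrEsg -[leRHS]mulrA.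
    apply: le_trans (_ : r * m j <= _).
      by have := em j; have := rm j; lra.
    by rewrite /m ler_wpM2r// m0.
  rewrite mul0r sub0r.
  have [ltij|ltji|/val_inj eij] := ltngtP i j; last by rewrite eij eqxx in ij.
    rewrite Ttrig// mulr0 /cdot/= !mulr0 addr0 mulr0.
    by have := em j; have := rm i; lra.
  apply: le_trans (cN _ _); rewrite -opprD lerN2.
  apply: le_trans (ler_wpM2l (ltW (k0 j)) (cdot_mul_le _ _ _ e0)) _.
  rewrite mulrDr mulrCA lerD2l /m [leRHS]mulrA mulrA ler_wpM2r//.
  exact: le_trans (ler_wpM2l (ltW (k0 j)) (tT i j)) (kt _ _ ltji).
apply: (@le_trans _ _ (\sum_j \sum_i ((i == j)%:R * (r * m j) - e * m j
      - r / (4 * n%:R) * m i))).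
  have -> : \sum_j \sum_i ((i == j)%:R * (r * m j) - e * m j
      - r / (4 * n%:R) * m i) = r / 4 * \sum_j m j.
    under eq_bigr do rewrite !big_split/= sumrN sumr_const card_ord.
    under eq_bigr => j _.
      rewrite (bigD1 j)//= eqxx mul1r big1 ?addr0; last first.
        by move=> i /negbTE ->; rewrite mul0r.
      over.
    rewrite !big_split/= !sumrN sumr_const card_ord -mulr_sumr.
    under [X in _ - X - _]eq_bigr do rewrite -mulr_natr.
    rewrite -mulr_suml -!mulr_sumr -mulr_natr /e.
    by field; rewrite gt_eqF.
  rewrite ler_wpM2l ?divr_ge0 ?(ltW r0)//.
  by apply: ler_sum => j _; rewrite /m ler_peMl.
apply: ler_sum => j _; rewrite mxE cdot_sumr mulr_sumr.
by apply: ler_sum => i _; exact: main.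
Qed.

(** The weighted form of [trig_mx_form_coercive] is pulled back through a Schur basis of the
    complexified matrix; its real bilinear version is the form of a real symmetric matrix. *)
Lemma lyapunov_form n (A : 'M[R]_n) : (0 < n)%N ->
  (forall z, eigenvalue (map_mx (real_complex R) A) z -> complex.Re z != 0) ->
  exists P : 'M[R]_n,
    [/\ P^T = P,
      exists2 c : R, 0 < c & forall u, c * `|u| ^+ 2 <= bform P u (u *m A) &
      (forall z, eigenvalue (map_mx (real_complex R) A) z ->
        complex.Re z < 0) ->
      exists2 c : R, 0 < c & forall u, bform P u u <= - (c * `|u| ^+ 2)].
Proof.
set AC := map_mx _ A => n0 hyp.
have [U Uunitary] := Schur AC n0.
have Uunit : U \in unitmx by exact: unitarymx_unit.
rewrite /similar_to conjumx//; set M := invmx U; set T := U *m AC *m M => Ttrig.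
have Teig j : eigenvalue AC (T j j).
  have /eigenvalueP[v vT v0] : eigenvalue T (T j j).
    rewrite eigenvalue_root_char char_poly_trig// /root horner_prod.
    rewrite prodf_seq_eq0; apply/hasP; exists j; rewrite ?mem_index_enum//=.
    by rewrite hornerXsubC subrr.
  apply/eigenvalueP; exists (v *m U).
    have -> : v *m U *m AC = v *m T *m U by rewrite /T !mulmxA mulmxKV.
    by rewrite vT -scalemxAl.
  by apply: contraNneq v0 => vU; rewrite -(mulmxK Uunit v) vU mul0mx.
have T0 j : complex.Re (T j j) != 0 by exact: hyp.
have [c [r [r0 cneg main]]] := trig_mx_form_coercive n0 Ttrig T0.
(* Coordinates in the Schur basis, where multiplication by [A] becomes multiplication by [T]. *)
pose w (u : 'rV[R]_n) := map_mx (real_complex R) u *m M.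
have wA u : w (u *m A) = w u *m T.
  by rewrite /w map_mxM/= -/AC /T !mulmxA mulmxKV.
pose Mr := map_mx (@complex.Re R) M; pose Mi := map_mx (@complex.Im R) M.
have wr u j : (u *m Mr) 0 j = complex.Re (w u 0 j).
  rewrite !mxE Re_sum; apply: eq_bigr => k _; rewrite !mxE; case: (M k j) => a b /=.
  by rewrite mul0r subr0.
have wi u j : (u *m Mi) 0 j = complex.Im (w u 0 j).
  rewrite !mxE Im_sum; apply: eq_bigr => k _; rewrite !mxE; case: (M k j) => a b /=.
  by rewrite mul0r addr0.
pose D := diag_mx (\row_j c j).
(* The real Gram matrix of the form with weights [c] in the coordinates [w]. *)
pose P := Mr *m D *m Mr^T + Mi *m D *m Mi^T.
have PE u v : bform P u v = \sum_j c j * cdot (w u 0 j) (w v 0 j).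
  have PX (X : 'M[R]_n) : (u *m (X *m D *m X^T) *m v^T) 0 0 =
      \sum_j c j * ((u *m X) 0 j * (v *m X) 0 j).
    rewrite !mulmxA -mulmxA -trmx_mul mul_mx_diag mxE; apply: eq_bigr => j _.
    rewrite [X in X * _]mxE [X in _ * X * _]mxE [X in _ * X]mxE.
    by rewrite -mulrA mulrCA.
  rewrite /bform /P mulmxDr mulmxDl mxE !PX -big_split/=; apply: eq_bigr => j _.
  by rewrite -mulrDr !wr !wi.
pose E u := \sum_j cdot (w u 0 j) (w u 0 j).
(* The coordinates control the norm because [u] is recovered as the real part of [w u *m U]. *)
have [K K0 KE] : exists2 K : R, 0 < K & forall u, K * `|u| ^+ 2 <= E u.
  pose Ur := map_mx (@complex.Re R) U; pose Ui := map_mx (@complex.Im R) U.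
  pose S (X : 'M[R]_n) : R := \sum_i \sum_j `|X i j|.
  have S0 X : 0 <= S X by do 2 (rewrite sumr_ge0// => ? _).
  pose K := 1 + S Ur + S Ui.
  have K0 : 0 < K by rewrite /K -addrA ltr_pwDl// addr_ge0.
  exists (K ^- 2) => [|u]; first by rewrite invr_gt0 exprn_gt0.
  rewrite ler_pdivrMl ?exprn_gt0//.
  have E0 : 0 <= E u by rewrite sumr_ge0// => j _; exact: cdot_ge0.
  rewrite -(sqr_sqrtr E0) -exprMn ler_pXn2r ?nnegrE ?mulr_ge0 ?sqrtr_ge0 ?(ltW K0)//.
  have uE : u = (u *m Mr) *m Ur - (u *m Mi) *m Ui.
    have uw : map_mx (real_complex R) u = w u *m U by rewrite mulmxKV.
    apply/rowP => j; have := congr1 (fun v : 'rV[R[i]]_n => complex.Re (v 0 j)) uw.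
    rewrite mxE/= => ->; rewrite !mxE Re_sum.
    rewrite -sumrB; apply: eq_bigr => k _; rewrite wr wi !mxE.
    by case: (\sum_i _) => a b; case: (U k j).
  have le_sqrtE x j : x ^+ 2 <= cdot (w u 0 j) (w u 0 j) -> `|x| <= Num.sqrt (E u).
    move=> xj; rewrite -sqrtr_sqr ler_wsqrtr// (le_trans xj)// /E (bigD1 j)//=.
    by rewrite lerDl sumr_ge0// => k _; exact: cdot_ge0.
  have nr : `|u *m Mr| <= Num.sqrt (E u).
    apply: row_norm_le => [|j]; first exact: sqrtr_ge0.
    by apply: (le_sqrtE _ j); rewrite wr /cdot -!expr2 lerDl sqr_ge0.
  have ni : `|u *m Mi| <= Num.sqrt (E u).
    apply: row_norm_le => [|j]; first exact: sqrtr_ge0.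
    by apply: (le_sqrtE _ j); rewrite wi /cdot -!expr2 lerDr sqr_ge0.
  rewrite [X in `|X|]uE (le_trans (ler_normB _ _))// /K -addrA mulrDl mul1r -[leLHS]add0r.
  rewrite lerD ?sqrtr_ge0// mulrDl lerD//.
    exact: le_trans (mulmx_norm_le _ _) (ler_wpM2l (S0 _) nr).
  exact: le_trans (mulmx_norm_le _ _) (ler_wpM2l (S0 _) ni).
exists P; split.
- by rewrite /P linearD/= !trmx_mul !trmxK tr_diag_mx !mulmxA.
- exists (r * K) => [|u]; first exact: mulr_gt0.
  rewrite PE wA -mulrA; apply: le_trans (main _).
  by rewrite ler_wpM2l// ltW.
move=> neg; exists K => // u; rewrite lerNr (le_trans (KE u))// PE -sumrN.
apply: ler_sum => j _; rewrite -mulNr ler_peMl ?cdot_ge0// lerNr.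
exact/cneg/neg.
Qed.

(** Let [a] and [b] be the real and imaginary parts of an eigenvector. When the values of the form
    at [(a, a *m A)] and [(b, b *m A)] are added, symmetry cancels the terms in the imaginary part
    of [z]. What remains is the real part of [z] times a nonpositive number, and coercivity makes
    this product positive. *)
Lemma lyapunov_form_stable n (A P : 'M[R]_n) (c : R) : P^T = P -> 0 < c ->
  (forall u, c * `|u| ^+ 2 <= bform P u (u *m A)) ->
  (forall u, bform P u u <= 0) ->
  forall z, eigenvalue (map_mx (real_complex R) A) z -> complex.Re z < 0.
Proof.
move=> PT c0 PA Pneg z /eigenvalueP[v vA v0].
pose a := map_mx (@complex.Re R) v; pose b := map_mx (@complex.Im R) v.
have aA : a *m A = complex.Re z *: a - complex.Im z *: b.
  apply/rowP => j; have := congr1 (fun v : 'rV[R[i]]_n => complex.Re (v 0 j)) vA.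
  rewrite !mxE Re_sum.
  have -> : \sum_i complex.Re (v 0 i * map_mx (real_complex R) A i j) =
      \sum_i a 0 i * A i j.
    apply: eq_bigr => i _; rewrite !mxE; case: (v 0 i) => x y /=.
    by rewrite mulr0 subr0.
  by move=> ->; case: z {vA} => p q; case: (v 0 j).
have bA : b *m A = complex.Im z *: a + complex.Re z *: b.
  apply/rowP => j; have := congr1 (fun v : 'rV[R[i]]_n => complex.Im (v 0 j)) vA.
  rewrite !mxE Im_sum.
  have -> : \sum_i complex.Im (v 0 i * map_mx (real_complex R) A i j) =
      \sum_i b 0 i * A i j.
    apply: eq_bigr => i _; rewrite !mxE; case: (v 0 i) => x y /=.
    by rewrite mulr0 add0r.
  by move=> ->; case: z {vA aA} => p q; case: (v 0 j) => x y /=; rewrite addrC.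
have ab : 0 < c * `|a| ^+ 2 + c * `|b| ^+ 2.
  have [a0|a0] := eqVneq a 0; last first.
    by rewrite ltr_pwDl ?mulr_ge0 ?sqr_ge0 ?(ltW c0)// mulr_gt0// exprn_gt0 ?normr_gt0.
  rewrite ltr_wpDl ?mulr_ge0 ?sqr_ge0 ?(ltW c0)// mulr_gt0// exprn_gt0 ?normr_gt0//.
  apply: contraNneq v0 => b0; apply/eqP/rowP => j; rewrite mxE.
  have := congr1 (fun x : 'rV[R]_n => x 0 j) a0.
  have := congr1 (fun x : 'rV[R]_n => x 0 j) b0.
  by rewrite !mxE; case: (v 0 j) => x y /= -> ->.
have := lt_le_trans ab (lerD (PA a) (PA b)).
rewrite aA bA !(bformDr, bformNr, bformZr) (bform_sym b a PT).
set x := complex.Re z; set y := complex.Im z; set ba := bform P a b.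
have -> : x * bform P a a - y * ba + (y * ba + x * bform P b b) =
  x * (bform P a a + bform P b b) by ring.
have := Pneg a; have := Pneg b => Pb Pa.
have Pab : bform P a a + bform P b b <= 0 by lra.
by apply: contraTT; rewrite -!leNgt => x0; rewrite mulr_ge0_le0.
Qed.

End LyapunovForm.

(** * Calculus of vector-valued curves and differential inequalities *)

Section VectorCalculus.
Context {R : realType} {N : nat}.
Implicit Types (x u w : R -> 'rV[R]_N) (I : set R).

Lemma is_derive_rVP x t (d : 'rV[R]_N) :
  is_derive (t : R) (1 : R) x d <->
  forall i, is_derive (t : R) (1 : R) (fun s => x s 0 i) (d 0 i).
Proof.
split=> [[dx <-] i|dx].
  have dxi := (derivable_mxP x t (1:R)).1 dx 0 i.
  by rewrite (derive_mx dx) mxE; exact: derivableP.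
have dx' : derivable x t (1:R).
  by apply/derivable_mxP => i j; rewrite ord1; case: (dx j).
apply: DeriveDef => //; rewrite (derive_mx dx').
by apply/rowP => j; rewrite mxE; case: (dx j).
Qed.

Lemma lipschitz_continuous (V W : normedModType R) (f : V -> W) (L : R) :
  (forall p q, `|f p - f q| <= L * `|p - q|) -> continuous f.
Proof.
move=> fL p; apply/cvgrPdist_le => e e0.
have L1 : 0 < `|L| + 1 by rewrite ltr_wpDl.
near=> q; apply: le_trans (fL _ _) _.
apply: (@le_trans _ _ ((`|L| + 1) * `|p - q|)).
  by rewrite ler_wpM2r// (le_trans (ler_norm _))// lerDl.
rewrite -ler_pdivlMl//; near: q; apply: cvgr_dist_le; first exact: cvg_id.
by rewrite mulr_gt0 ?invr_gt0.
Unshelve. all: by end_near. Qed.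

Lemma continuous_rVP (T : topologicalType) (f : T -> 'rV[R]_N) :
  continuous f <-> forall i, continuous (fun s => f s 0 i).
Proof.
split=> [cf i s|cf s].
  apply: (@continuous_comp _ _ _ f (fun M : 'rV[R]_N => M 0 i)).
    exact: cf.
  exact: (@coord_continuous _ 1 N 0 i (f s)).
apply/cvgrPdist_le => e e0; near=> z.
apply: row_norm_le => [|i]; first exact: ltW.
rewrite !mxE; move: i; near: z; apply: filter_forall => i.
by move/(_ i s)/cvgrPdist_le : cf => /(_ _ e0).
Unshelve. all: by end_near. Qed.

Lemma is_derive_bform (P : 'M[R]_N) u w t (du dw : 'rV[R]_N) :
  is_derive (t : R) (1 : R) u du -> is_derive (t : R) (1 : R) w dw ->
  is_derive (t : R) (1 : R) (fun s => bform P (u s) (w s))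
    (bform P du (w t) + bform P (u t) dw).
Proof.
move=> /is_derive_rVP hu /is_derive_rVP hw.
have -> : (fun s => bform P (u s) (w s)) =
    \sum_i \sum_j (fun s => u s 0 i * P i j * w s 0 j).
  apply/funext => s; rewrite bformE fct_sumE; apply: eq_bigr => i _.
  by rewrite fct_sumE.
rewrite !bformE -big_split/=; apply: is_derive_sum => i.
rewrite -big_split/=; apply: is_derive_sum => j.
have hui := hu i; have hwj := hw j.
have -> : (fun s => u s 0 i * P i j * w s 0 j) =
    (P i j \*: (fun s => u s 0 i)) * (fun s => w s 0 j).
  by apply/funext => s; congr (_ * _); exact: mulrC.
apply: is_derive_eq; rewrite /GRing.scale/= addrC; congr (_ + _); last by ring.
by congr (_ * _); exact: mulrC.
Qed.

Lemma continuous_bform (T : topologicalType) (P : 'M[R]_N)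
    (u w : T -> 'rV[R]_N) :
  continuous u -> continuous w -> continuous (fun s => bform P (u s) (w s)).
Proof.
move=> /continuous_rVP cu /continuous_rVP cw s.
have -> : (fun s => bform P (u s) (w s)) =
    (fun s => \sum_i \sum_j (u s 0 i * P i j * w s 0 j)).
  by apply/funext => z; rewrite bformE.
apply: cvg_big => [|i _]; first exact: add_continuous.
apply: cvg_big => [|j _]; first exact: add_continuous.
by apply: cvgM (cw j s); apply: cvgM (cu i s) _; exact: cvg_cst.
Qed.

(** The function [expR (- k * t) * phi t] has nonpositive derivative, so by the mean value theorem
    it does not increase. The rate [k] may have either sign. *)
Lemma growth_le (phi dphi : R -> R) (a b k : R) : a <= b ->
  {within `[a, b], continuous phi} ->
  (forall t, t \in `]a, b[ -> is_derive (t : R) (1 : R) phi (dphi t)) ->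
  (forall t, t \in `]a, b[ -> dphi t <= k * phi t) ->
  phi b <= expR (k * (b - a)) * phi a.
Proof.
rewrite le_eqVlt => /predU1P[-> *|ab cphi hphi le_phi].
  by rewrite subrr mulr0 expR0 mul1r.
pose psi t := expR (- k * t) * phi t.
have dexp t : is_derive (t : R) (1 : R) (fun s => expR (- k * s))
    (- k * expR (- k * t)).
  have : is_derive (t : R) (1 : R) (expR \o (- k \*: id))
      (- k *: 1 * expR (- k * t)).
    by apply: is_derive_eq; rewrite /GRing.scale/= mulrC.
  by rewrite /GRing.scale/= mulr1.
have dpsi t : t \in `]a, b[ ->
    is_derive (t : R) (1 : R) psi (expR (- k * t) * (dphi t - k * phi t)).
  move=> tab; have := hphi _ tab; have := dexp t => ? ?.
  rewrite (_ : psi = (fun s => expR (- k * s)) * phi)//.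
  by apply: is_derive_eq; rewrite /GRing.scale/=; ring.
have cpsi : {within `[a, b], continuous psi}.
  move=> s; apply: (@cvgM _ (subspace `[a, b]) _ _ (fun s => expR (- k * s)) phi).
    apply: (@continuous_subspaceT _ _ _ (fun s => expR (- k * s))) => z.
    by have [/derivable1_diffP/differentiable_continuous] := dexp z.
  exact: cphi.
have [c cab E] := MVT ab dpsi cpsi.
have : psi b <= psi a.
  rewrite -subr_le0 E -mulrA mulr_ge0_le0 ?expR_ge0//.
  rewrite mulr_le0_ge0 ?subr_le0 ?le_phi//.
  by rewrite subr_ge0 ltW.
rewrite /psi mulNr mulNr expRN => psiab.
have : phi b <= expR (k * b) * (expR (- (k * a)) * phi a).
  by rewrite -ler_pdivrMl ?expR_gt0.
by rewrite mulrA -expRD -mulrBr.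
Qed.

(** In the max norm it suffices to bound each coordinate with either sign; the scalar mean value
    theorem applies to [phi] minus the signed coordinate. *)
Lemma comparison_le x (dx : R -> 'rV[R]_N) (phi dphi : R -> R) (a b : R) :
  a <= b ->
  {within `[a, b], continuous x} -> {within `[a, b], continuous phi} ->
  (forall t, t \in `]a, b[ -> is_derive (t : R) (1 : R) x (dx t)) ->
  (forall t, t \in `]a, b[ -> is_derive (t : R) (1 : R) phi (dphi t)) ->
  (forall t, t \in `]a, b[ -> `|dx t| <= dphi t) ->
  `|x b - x a| <= phi b - phi a.
Proof.
rewrite le_eqVlt => /predU1P[-> *|ab cx cphi hx hphi le_dx].
  by rewrite !subrr normr0.
have half (s : bool) i : (-1) ^+ s * (x b 0 i - x a 0 i) <= phi b - phi a.
  pose psi := phi - ((-1) ^+ s \*: (fun t => x t 0 i)).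
  have dpsi t : t \in `]a, b[ ->
      is_derive (t : R) (1 : R) psi (dphi t - (-1) ^+ s * dx t 0 i).
    move=> tab; have ? := hphi _ tab; have ? := (is_derive_rVP _ _ _).1 (hx _ tab) i.
    exact: is_derive_eq.
  have cpsi : {within `[a, b], continuous psi}.
    move=> t; apply: (@cvgB _ _ (subspace `[a, b])); first exact: cphi.
    apply: (@cvgM _ (subspace `[a, b]) _ _ (cst ((-1) ^+ s)) (fun t => x t 0 i)).
      exact: cvg_cst.
    exact: (proj1 (continuous_rVP (x : subspace `[a, b] -> _)) cx i t).
  have [c cab E] := MVT ab dpsi cpsi.
  have : 0 <= psi b - psi a.
    rewrite E mulr_ge0 ?subr_ge0 ?(ltW ab)//.
    apply: le_trans (le_dx _ cab); apply: le_trans (row_coord_le_norm _ i).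
    by case: (s); rewrite ?mulN1r ?mul1r ?ler_norm// -normrN ler_norm.
  rewrite -[psi b]/(phi b - (-1) ^+ s * x b 0 i).
  rewrite -[psi a]/(phi a - (-1) ^+ s * x a 0 i) mulrBr; lra.
apply: row_norm_le => [|i].
  have [c cab ->] := MVT ab hphi cphi.
  by rewrite mulr_ge0 ?subr_ge0 ?(ltW ab)// (le_trans _ (le_dx _ cab)).
rewrite !mxE ler_norml; have := half true i; have := half false i.
by rewrite expr0 expr1; lra.
Qed.

End VectorCalculus.

(** * Global forward existence for Lipschitz fields by Picard iteration *)

Section Picard.
Context {R : realType} {N : nat}.

(* Integrating from [-1] rather than from [0] makes the primitive two-sided
   differentiable at [0]. *)
Definition primitive (h : R -> R) (t : R) : R :=
  (\int[lebesgue_measure]_(s in `[-1, t]) h s -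
   \int[lebesgue_measure]_(s in `[-1, 0]) h s)%R.

Lemma is_derive_primitive (h : R -> R) (t : R) : continuous h -> 0 <= t ->
  is_derive t (1 : R) (primitive h) (h t).
Proof.
move=> ch t0.
have [||||dF Ft] := @continuous_FTC1_closed R h (-1) t (t + 1).
- by rewrite ltrDl.
- apply: continuous_compact_integrable; first exact: segment_compact.
  exact: continuous_subspaceT.
- by rewrite (lt_le_trans _ t0)// ltrN10.
- exact: ch.
rewrite -[h t]subr0; apply: is_deriveB.
by apply: DeriveDef; [exact: dF|rewrite -derive1E].
Qed.

Variables (G : 'rV[R]_N -> 'rV[R]_N) (L : R) (x0 : 'rV[R]_N).
Hypotheses (L0 : 0 < L) (GL : forall p q, `|G p - G q| <= L * `|p - q|).

Let Gcont : continuous G.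
Proof. exact: lipschitz_continuous GL. Qed.

(** Replacing [s] by [Num.max s 0] extends [u] to negative times by its value at [0], so that the
    integrand is continuous on the whole line. *)
Definition picard_map (u : R -> 'rV[R]_N) (t : R) : 'rV[R]_N :=
  x0 + \row_i primitive (fun s : R => G (u (Num.max s 0)) 0 i) t.

Definition halfline_continuous (u : R -> 'rV[R]_N) : Prop :=
  continuous (fun s : R => u (Num.max s 0)).

Let picard_map0 u : picard_map u 0 = x0.
Proof.
apply/rowP => i; rewrite !mxE /primitive.
by rewrite subrr addr0.
Qed.

Let is_derive_picard_map u (t : R) : halfline_continuous u -> 0 <= t ->
  is_derive t (1 : R) (picard_map u) (G (u t)).
Proof.
move=> cu t0; apply/is_derive_rVP => i.
have cGu : continuous (fun s : R => G (u (Num.max s 0)) 0 i).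
  apply: (continuous_rVP (fun s : R => G (u (Num.max s 0)))).1 => s.
  apply: (@continuous_comp _ _ _ (fun s : R => u (Num.max s 0)) G); first exact: cu.
  exact: Gcont.
have := is_derive_primitive cGu t0; rewrite /= max_l// => dp.
have -> : (fun s => picard_map u s 0 i) =
    cst (x0 0 i) + primitive (fun s : R => G (u (Num.max s 0)) 0 i).
  by apply/funext => s; rewrite !mxE.
by rewrite -[G _ _ _]add0r; apply: is_deriveD.
Qed.

Let max0_continuous : continuous (fun s : R => Num.max s 0).
Proof.
apply: (@lipschitz_continuous _ _ _ _ 1) => a b; rewrite mul1r.
have [] := lerP a 0; have [] := lerP b 0; have := ler_norm (a - b);
  have := ler_norm (b - a); rewrite (distrC b a) => *;
  rewrite ler_norml; apply/andP; split; lra.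
Qed.

Let halfline_continuous_derive u du :
  (forall t : R, 0 <= t -> is_derive t (1 : R) u (du t)) -> halfline_continuous u.
Proof.
move=> hu s; apply: (@continuous_comp _ _ _ (fun s : R => Num.max s 0) u).
  exact: max0_continuous.
have s0 : 0 <= Num.max s 0 by rewrite le_max lexx orbT.
by have [/derivable1_diffP/differentiable_continuous] := hu _ s0.
Qed.

Let halfline_continuous_picard_map u :
  halfline_continuous u -> halfline_continuous (picard_map u).
Proof.
move=> cu; apply: (@halfline_continuous_derive _ (fun t => G (u t))) => t t0.
exact: is_derive_picard_map.
Qed.

(* The weight [expR (2 * L * t)] makes the Picard map a contraction of ratio
   1/2 on the whole half-line. *)
Let picard_map_contract (u v : R -> 'rV[R]_N) (k : R) :
  halfline_continuous u -> halfline_continuous v ->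
  (forall t, 0 <= t -> `|u t - v t| <= k * expR (2 * L * t)) ->
  forall t, 0 <= t ->
    `|picard_map u t - picard_map v t| <= k / 2 * expR (2 * L * t).
Proof.
move=> cu cv uv t t0.
have k0 : 0 <= k.
  have := uv 0 (lexx 0); rewrite mulr0 expR0 mulr1.
  exact: le_trans.
pose d s := picard_map u s - picard_map v s.
pose phi s := k / 2 * expR (2 * L * s).
have dd (s : R) : 0 <= s -> is_derive s (1 : R) d (G (u s) - G (v s)).
  move=> s0; have ? := is_derive_picard_map cu s0.
  by have ? := is_derive_picard_map cv s0; exact: is_deriveB.
have dphi (s : R) : is_derive s (1 : R) phi (L * (k * expR (2 * L * s))).
  have : is_derive s (1 : R) ((k / 2) \*: (expR \o (2 * L \*: id)))
      (k / 2 *: (2 * L *: 1 * expR (2 * L * s))).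
    by apply: is_derive_eq; rewrite /GRing.scale/=; congr (_ * _); rewrite mulrC.
  rewrite /GRing.scale/= mulr1.
  have -> : k / 2 * (2 * L * expR (2 * L * s)) = L * (k * expR (2 * L * s)) by field.
  by [].
have cphi : {within `[0, t], continuous phi}.
  by apply: derivable_within_continuous => s _; case: (dphi s).
have cd : {within `[0, t], continuous d}.
  apply: derivable_within_continuous => s; rewrite in_itv/= => /andP[s0 _].
  by case: (dd s s0).
have := @comparison_le R N d (fun s => G (u s) - G (v s)) phi _ 0 t t0 cd cphi _
  (fun s _ => dphi s).
have d0 : d 0 = 0 by rewrite /d !picard_map0 subrr.
rewrite d0 subr0 => /(_ _ _)/le_trans; apply.
- by move=> s; rewrite in_itv/= => /andP[/ltW s0 _]; exact: dd.
- move=> s; rewrite in_itv/= => /andP[/ltW s0 _].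
  by apply: le_trans (GL _ _) _; rewrite ler_pM2l// uv.
by rewrite lerBlDr lerDl mulr_ge0 ?divr_ge0 ?expR_ge0.
Qed.

Let u_ n : R -> 'rV[R]_N := iter n picard_map (cst x0).

Let u_cont n : halfline_continuous (u_ n).
Proof.
elim: n => [|n IH]; last exact: halfline_continuous_picard_map.
by move=> s; exact: cvg_cst.
Qed.

(** The first Picard step has size at most [t] times the norm of [G x0], which equals
    [C * (2 * L * t)] and is therefore below [C * expR (2 * L * t)]. *)
Let C := `|G x0| / (2 * L).

Let C0 : 0 <= C. Proof. by rewrite divr_ge0// mulr_ge0// ltW. Qed.

Let u_step n t : 0 <= t ->
  `|u_ n.+1 t - u_ n t| <= C * 2^-1 ^+ n * expR (2 * L * t).
Proof.
elim: n t => [|n IH] t t0; last first.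
  rewrite exprSr mulrA.
  rewrite -[u_ n.+2 t]/(picard_map (u_ n.+1) t) -[u_ n.+1 t]/(picard_map (u_ n) t).
  apply: picard_map_contract => //; exact: u_cont.
rewrite expr0 mulr1.
pose phi (s : R) := s * `|G x0|.
have cphi : {within `[0, t], continuous phi}.
  by apply: continuous_subspaceT => s; apply: cvgM; [exact: cvg_id|exact: cvg_cst].
have dphi (s : R) : is_derive s (1 : R) phi `|G x0|.
  have -> : phi = `|G x0| \*: id by apply/funext => z; rewrite /phi mulrC.
  by apply: is_derive_eq; rewrite /GRing.scale/= mulr1.
have du (s : R) : 0 <= s -> is_derive s (1 : R) (u_ 1) (G x0).
  by move=> s0; exact: (@is_derive_picard_map (u_ 0) s (@u_cont 0) s0).
have cu : {within `[0, t], continuous (u_ 1)}.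
  apply: derivable_within_continuous => s; rewrite in_itv/= => /andP[s0 _].
  by case: (du s s0).
have := @comparison_le R N (u_ 1) (fun=> G x0) phi _ 0 t t0 cu cphi _
  (fun s _ => dphi s).
rewrite [u_ 1 0]picard_map0 => /(_ _ _)/le_trans; apply => //.
  by move=> s; rewrite in_itv/= => /andP[/ltW s0 _]; exact: du.
rewrite /phi mul0r subr0 /C mulrAC ler_pdivlMr ?mulr_gt0//.
have -> : t * `|G x0| * (2 * L) = `|G x0| * (2 * L * t) by ring.
by rewrite ler_wpM2l// (le_trans _ (expR_ge1Dx _))// lerDr.
Qed.

Let pow_ge0 n : 0 <= 2 * C * 2^-1 ^+ n.
Proof. by apply: mulr_ge0; [exact: mulr_ge0|exact: exprn_ge0]. Qed.

Let u_cauchy n k t : 0 <= t ->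
  `|u_ (n + k) t - u_ n t| <= 2 * C * 2^-1 ^+ n * expR (2 * L * t).
Proof.
(* Subtracting the tail of the geometric series strengthens the bound enough for the induction on
   [k] to close. *)
move=> t0; suff: `|u_ (n + k) t - u_ n t| <=
    (2 * C * 2^-1 ^+ n - 2 * C * 2^-1 ^+ (n + k)) * expR (2 * L * t).
  move=> /le_trans; apply; rewrite ler_wpM2r ?expR_ge0// lerBlDr lerDl.
  exact: pow_ge0.
elim: k => [|k IH]; first by rewrite addn0 !subrr normr0 mul0r.
rewrite -(subrKA (u_ (n + k) t)) (le_trans (ler_normD _ _))// addnS.
apply: le_trans (lerD (u_step (n + k) t0) IH) _.
by rewrite -mulrDl ler_wpM2r ?expR_ge0// exprSr; lra.
Qed.

Let half_lt (A e : R) : 0 < e -> \forall n \near \oo, A * 2^-1 ^+ n < e.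
Proof.
move=> e0; have : A * 2^-1 ^+ n @[n --> \oo] --> A * 0.
  apply: cvgM; first exact: cvg_cst.
  by apply: cvg_expr; rewrite ger0_norm ?invr_ge0// invf_lt1// ltr1n.
rewrite mulr0 => /cvgrPdist_lt/(_ e e0); apply: filterS => n.
by rewrite sub0r normrN; exact: le_lt_trans (ler_norm _).
Qed.

Let w t : 'rV[R]_N := lim (u_ n t @[n --> \oo]).

Let u_cvg t : 0 <= t -> u_ n t @[n --> \oo] --> w t.
Proof.
move=> t0; apply/cauchy_cvgP; apply: cauchy_exP => e e0.
have [n _ nP] := half_lt (2 * C * expR (2 * L * t)) e0.
exists (u_ n t); exists n => // m /= nm; rewrite -ball_normE/= distrC.
rewrite -(subnKC nm); apply: le_lt_trans (u_cauchy _ _ t0) _.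
by rewrite mulrAC; exact: (nP n (leqnn n)).
Qed.

Let u_w n t : 0 <= t ->
  `|w t - u_ n t| <= 2 * C * 2^-1 ^+ n * expR (2 * L * t).
Proof.
move=> t0.
have : `|u_ (k + n) t - u_ n t| @[k --> \oo] --> `|w t - u_ n t|.
  apply: cvg_norm; apply: cvgB; last exact: cvg_cst.
  by rewrite (cvg_shiftn n (fun k => u_ k t)); exact: u_cvg.
move=> h; rewrite -(cvg_lim (@Rhausdorff _) h); apply: limr_le; first exact: cvgP h.
by near=> k; rewrite addnC; exact: u_cauchy.
Unshelve. all: by end_near. Qed.

(** The iterates converge uniformly on bounded time intervals, so continuity passes to the limit by
    splitting [e] into three parts. *)
Let w_cont : halfline_continuous w.
Proof.
move=> s; apply/cvgrPdist_le => e e0.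
pose B := expR (2 * L * (`|s| + 1)).
have e3 : 0 < e / 3 by rewrite divr_gt0.
have [n _ /(_ n (leqnn n)) nP] := half_lt (2 * C * B) e3.
have near_w z : z <= `|s| + 1 -> `|w (Num.max z 0) - u_ n (Num.max z 0)| <= e / 3.
  move=> zs; have z0 : 0 <= Num.max z 0 by rewrite le_max lexx orbT.
  apply: le_trans (u_w n z0) _; apply: le_trans (ltW nP); rewrite [leRHS]mulrAC.
  rewrite [leRHS]mulrAC [leRHS]mulrAC ler_wpM2l ?pow_ge0// ler_expR.
  rewrite ler_wpM2l ?mulr_ge0 ?(ltW L0)//.
  by rewrite ge_max zs/= addr_ge0.
near=> z.
rewrite -(subrKA (u_ n (Num.max s 0))) (le_trans (ler_normD _ _))//.
rewrite -(subrKA (u_ n (Num.max z 0)) (u_ n (Num.max s 0))).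
rewrite (_ : e = e / 3 + (e / 3 + e / 3)); last by field.
apply: lerD; first by apply: near_w; rewrite (le_trans (ler_norm _))// lerDl.
apply: le_trans (ler_normD _ _) (lerD _ _); last first.
  rewrite distrC near_w//; near: z.
  have : s < `|s| + 1 by rewrite (le_lt_trans (ler_norm _))// ltrDl.
  by move=> /lt_nbhsl; apply: filterS => z /ltW.
by near: z; move: (@u_cont n s) => /cvgrPdist_le/(_ _ e3).
Unshelve. all: by end_near. Qed.

(** The limit [w] of the iterates is a fixed point of the Picard map, since both [w] and
    [picard_map w] are arbitrarily close to [u_ n.+1]. The solution provided has a two-sided
    derivative even at time [0]. *)
Lemma lipschitz_solution : exists2 x : R -> 'rV[R]_N, x 0 = x0 &
  forall t : R, 0 <= t -> is_derive t (1 : R) x (G (x t)).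
Proof.
exists (picard_map w); first exact: picard_map0.
move=> t t0; suff -> : picard_map w t = w t.
  exact: (is_derive_picard_map w_cont t0).
apply/eqP; rewrite -subr_eq0 -normr_le0; apply/ler_addgt0Pl => e e0.
have [n _ /(_ n (leqnn n)) nP] := half_lt (2 * C * expR (2 * L * t)) e0.
rewrite addr0 -(subrKA (u_ n.+1 t)) (le_trans (ler_normD _ _))// (distrC _ (w t)).
have h1 := @picard_map_contract w (u_ n) (2 * C * 2^-1 ^+ n) w_cont (@u_cont n)
   (fun s => @u_w n s) t t0.
have h2 := @u_w n.+1 t t0.
apply: le_trans (lerD h1 h2) _; apply: le_trans _ (ltW nP).
rewrite le_eqVlt; apply/orP; left; apply/eqP; rewrite exprSr.
by field.
Qed.

End Picard.

(** * Mean value estimates: local Lipschitz bounds and linearization *)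

Lemma is_derive_comp_diff (R : realType) (V W : normedModType R) (G : V -> W)
    (c : R -> V) (s : R) (dc : V) :
  is_derive s (1 : R) c dc -> differentiable G (c s) ->
  is_derive s (1 : R) (fun t => G (c t)) ('d G (c s) dc).
Proof.
move=> [/derivable1_diffP dfc <-] dG.
have dGc : differentiable (G \o c) s by exact: differentiable_comp.
apply: DeriveDef; first exact/derivable1_diffP.
by rewrite deriveE// diff_comp//= deriveE.
Qed.

Section MeanValue.
Context {R : realType} {N : nat}.
Implicit Types (G : 'rV[R]_N -> 'rV[R]_N) (p q y : 'rV[R]_N).

Lemma segment_norm_le (V : normedModType R) (p q y : V) (s e : R) :
  0 <= s -> s <= 1 -> `|p - y| <= e -> `|q - y| <= e ->
  `|p + s *: (q - p) - y| <= e.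
Proof.
move=> s0 s1 py qy.
have -> : p + s *: (q - p) - y = (1 - s) *: (p - y) + s *: (q - y).
  rewrite (_ : q - p = (q - y) - (p - y)); last by rewrite opprB addrA subrK.
  rewrite scalerBl scale1r (scalerBr _ (q - y)) !addrA.
  by rewrite [LHS]addrAC [X in X - _ = _]addrAC [LHS]addrAC.
rewrite (le_trans (ler_normD _ _))// !normrZ ger0_norm ?subr_ge0// ger0_norm//.
have -> : e = (1 - s) * e + s * e by ring.
by rewrite lerD ?ler_wpM2l ?subr_ge0.
Qed.

(** The curve [G (p + s *: (q - p)) - s *: ((q - p) *m A)] has derivative bounded by [e] times the
    norm of [q - p]. Taking [A] zero yields Lipschitz bounds; taking the Jacobian yields
    linearization estimates. *)
Lemma mean_value_le G (A : 'M[R]_N) (e : R) p q :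
  (forall s : R, 0 <= s -> s <= 1 -> differentiable G (p + s *: (q - p)) /\
    forall h, `|'d G (p + s *: (q - p)) h - h *m A| <= e * `|h|) ->
  `|G q - G p - (q - p) *m A| <= e * `|q - p|.
Proof.
move=> hG; set h := q - p.
pose x s := G (p + s *: h) - s *: (h *m A).
pose dx s := 'd G (p + s *: h) h - h *m A.
have hx (s : R) : 0 <= s -> s <= 1 -> is_derive s (1 : R) x (dx s).
  move=> s0 s1; have [dG _] := hG s s0 s1.
  have dl (w : 'rV[R]_N) : is_derive s (1 : R) (fun s : R => s *: w) w.
    apply/is_derive_rVP => i.
    have -> : (fun s : R => (s *: w) 0 i) = w 0 i \*: id.
      by apply/funext => t; rewrite mxE mulrC.
    by apply: is_derive_eq; rewrite /GRing.scale/= mulr1.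
  apply: is_deriveB.
  apply: (@is_derive_comp_diff _ _ _ G (fun s => p + s *: h)) => //.
  by rewrite -[h in X in is_derive _ _ _ X]add0r; apply: is_deriveD.
pose phi (s : R) := s * (e * `|h|).
have dphi (s : R) : is_derive s (1 : R) phi (e * `|h|).
  have -> : phi = (e * `|h|) \*: id by apply/funext => z; rewrite /phi mulrC.
  by apply: is_derive_eq; rewrite /GRing.scale/= mulr1.
have cphi : {within `[0, 1], continuous phi}.
  by apply: derivable_within_continuous => s _; case: (dphi s).
have cx : {within `[0, 1], continuous x}.
  apply: derivable_within_continuous => s; rewrite in_itv/= => /andP[s0 s1].
  by case: (hx s s0 s1).
have := @comparison_le R N x dx phi _ 0 1 ler01 cx cphi _ (fun s _ => dphi s).
rewrite /phi mul1r mul0r subr0 /x !scale1r !scale0r addr0 subr0 /h subrKC.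
have -> : G q - (q - p) *m A - G p = G q - G p - (q - p) *m A by rewrite addrAC.
apply => s; rewrite in_itv/= => /andP[/ltW s0 /ltW s1]; first exact: hx.
by have [_] := hG s s0 s1; apply.
Qed.

Lemma diff_jacobian G p h : differentiable G p ->
  'd G p h = h *m jacobian G p.
Proof. by move=> dG; rewrite -deriveE// deriveEjacobian. Qed.

Lemma locally_lipschitz G (rho : R) : continuously_differentiable G ->
  exists2 L : R, 0 < L &
    forall p q, `|p| <= rho -> `|q| <= rho -> `|G p - G q| <= L * `|p - q|.
Proof.
move=> [dG cG].
pose K := [set p : 'rV[R]_N | `|p| <= rho].
have cK : compact K.
  apply: bounded_closed_compact.
    exists rho; split; first exact: num_real.
    by move=> M rM p /= /le_trans; apply; exact: ltW.
  have -> : K = (fun p : 'rV[R]_N => `|p|) @^-1` [set x | x <= rho] by [].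
  by apply: preimage_closed; [move=> p _; exact: norm_continuous|exact: closed_le].
(* Compactness turns the bounds on the differential near each point into a single bound [M] on the
   whole ball. *)
have := (compact_near_coveringP K).1 cK R +oo%R
  (fun M q => forall h, `|'d G q h| <= M * `|h|).
move=> /(_ _ _)[p Kp|M [Mreal KM]].
  pose C := \sum_i \sum_j `|jacobian G p i j|.
  near=> q M => h /=.
  rewrite -(subrK ('d G p h) ('d G q h)) (le_trans (ler_normD _ _))//.
  apply: (@le_trans _ _ (1 * `|h| + C * `|h|)).
    apply: lerD; last by rewrite diff_jacobian//; exact: mulmx_norm_le.
    by move: h; near: q; exact: cG.
  by rewrite -mulrDl ler_wpM2r//; near: M; exact: nbhs_pinfty_ge.
exists (Num.max M 0 + 1) => [|p q Kp Kq].
  by rewrite ltr_wpDl// le_max lexx orbT.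
have := @mean_value_le G 0 (Num.max M 0 + 1) q p.
rewrite mulmx0 subr0; apply => s s0 s1.
split=> [|h]; first exact: dG.
rewrite mulmx0 subr0; apply: KM.
  by have : M <= Num.max M 0 by [rewrite le_max lexx]; lra.
rewrite /K/= -[X in `|X|]subr0; apply: segment_norm_le => //; rewrite subr0.
Unshelve. all: by end_near. Qed.

Lemma linearization_le G y (e : R) : continuously_differentiable G -> 0 < e ->
  exists2 r : R, 0 < r &
    forall p q, `|p - y| <= r -> `|q - y| <= r ->
      `|G p - G q - (p - q) *m jacobian G y| <= e * `|p - q|.
Proof.
move=> [dG cG] e0.
have /nbhs_ballP[r /= r0 rP] := cG y e e0.
(* Halving the radius puts the closed ball, and with it the segment, inside the open ball where [rP]
   applies. *)
exists (r / 2) => [|p q py qy]; first by rewrite divr_gt0.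
apply: mean_value_le => s s0 s1; split => [|h]; first exact: dG.
rewrite -diff_jacobian//; apply: rP.
rewrite -ball_normE/= distrC; apply: le_lt_trans (segment_norm_le s0 s1 qy py) _.
by rewrite ltr_pdivrMr// ltr_pMr// ltr1n.
Qed.

End MeanValue.

(** * Truncation onto a closed ball *)

Section Clip.
Context {R : realType} {N : nat}.
Implicit Types p q : 'rV[R]_N.

(** The coordinatewise retraction onto the max-norm ball. Composing a locally Lipschitz field with
    it yields a globally Lipschitz field that is unchanged on the ball. *)
Definition clip (rho : R) p : 'rV[R]_N :=
  \row_i Num.max (- rho) (Num.min rho (p 0 i)).

Lemma clip_norm_le rho p : 0 <= rho -> `|clip rho p| <= rho.
Proof.
move=> rho0; apply: row_norm_le => // i; rewrite mxE ler_norml.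
rewrite le_max lexx/= ge_max ge_min lexx/= andbT.
lra.
Qed.

Lemma clip_id rho p : `|p| <= rho -> clip rho p = p.
Proof.
move=> prho; apply/rowP => i; rewrite mxE.
have := le_trans (row_coord_le_norm p i) prho; rewrite ler_norml => /andP[l r].
by rewrite min_r// max_r.
Qed.

Lemma clip_lipschitz rho p q : `|clip rho p - clip rho q| <= `|p - q|.
Proof.
apply: row_norm_le => // i; rewrite !mxE.
apply: le_trans (row_coord_le_norm (p - q) i); rewrite !mxE.
set a := p 0 i; set b := q 0 i.
have min_le (x z : R) : `|Num.min rho x - Num.min rho z| <= `|x - z|.
  have := ler_norm (x - z); have := ler_norm (z - x); rewrite (distrC z x) => *.
  by have [] := lerP rho x; have [] := lerP rho z => *;
    rewrite ler_norml; apply/andP; split; lra.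
have max_le (x z : R) : `|Num.max (- rho) x - Num.max (- rho) z| <= `|x - z|.
  have := ler_norm (x - z); have := ler_norm (z - x); rewrite (distrC z x) => *.
  by have [] := lerP (- rho) x; have [] := lerP (- rho) z => *;
    rewrite ler_norml; apply/andP; split; lra.
exact: le_trans (max_le _ _) (min_le _ _).
Qed.

End Clip.

(** * Solutions under restriction and affine change of time *)

Section Solutions.
Context {R : realType} {N : nat}.
Implicit Types (F : 'rV[R]_N -> R -> 'rV[R]_N) (x : R -> 'rV[R]_N) (I J : set R).

Lemma solution_on_subset F I J x : J `<=` I -> solution_on F I x ->
  solution_on F J x.
Proof.
move=> JI [cx dx]; split; first exact: continuous_subspaceW cx.
by move=> t /(interiorS JI); exact: dx.
Qed.

Lemma solution_on_derive F I x :
  (forall t : R, I t -> is_derive t (1 : R) x (F (x t) t)) -> solution_on F I x.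
Proof.
move=> dx; split=> [|t /interior_subset]; last exact: dx.
apply: continuous_in_subspaceT => t /set_mem It.
by have [/derivable1_diffP/differentiable_continuous] := dx t It.
Qed.

Lemma solution_on_itv F (a b t : R) x : solution_on F `[a, b] x ->
  t \in `]a, b[ -> is_derive t (1 : R) x (F (x t) t).
Proof. by move=> [_ dx] tab; apply: dx; rewrite interior_itv_bnd. Qed.

Lemma solution_on_affine F I x (k c : R) : k != 0 -> solution_on F I x ->
  solution_on (fun z t => k *: F z (k * t + c)) [set t | I (k * t + c)]
    (fun t => x (k * t + c)).
Proof.
move=> k0 [/subspace_continuousP cx dx].
pose phi (t : R) := k * t + c; pose psi (t : R) := k^-1 * (t - c).
have phiK t : psi (phi t) = t by rewrite /psi /phi addrK mulKf.
have psiK t : phi (psi t) = t by rewrite /psi /phi mulVKf// subrK.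
have dphi (t : R) : is_derive t (1 : R) phi k.
  rewrite -[k in X in is_derive _ _ _ X]addr0; apply: is_deriveD.
  have -> : ( *%R k) = k \*: (id : R -> R) by [].
  by apply: is_derive_eq; rewrite /GRing.scale/= mulr1.
have cphi : continuous phi.
  by move=> t; have [/derivable1_diffP/differentiable_continuous] := dphi t.
have cpsi : continuous psi.
  move=> t; apply: cvgM; first exact: cvg_cst.
  by apply: cvgB; [exact: cvg_id|exact: cvg_cst].
split=> [|t It].
  apply/subspace_continuousP => t It B /(cx _ It) xB.
  exact: cphi xB.
(* The continuous inverse [psi] carries neighbourhoods of [t] to neighbourhoods of [phi t], so
   interior times correspond. *)
have {}It : I° (phi t).
  have H : nbhs (phi t) (psi @^-1` [set t | I (phi t)]).
    by apply: cpsi; rewrite phiK.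
  by apply: filterS H => s /=; rewrite psiK.
have dxt := dx _ It.
have [/derivable1_diffP dfx Dx] := dxt; have [/derivable1_diffP dfphi Dphi] := dphi t.
apply: (is_derive_eq (@is_derive_comp_diff _ _ _ x phi t _ (dphi t) dfx)).
have -> : k = k *: (1 : R) by rewrite /GRing.scale/= mulr1.
by rewrite linearZ/= -deriveE// Dx /GRing.scale/= mulr1.
Qed.

Lemma solution_on_bounded F (a b : R) x : a <= b -> solution_on F `[a, b] x ->
  exists rho : R, forall t, t \in `[a, b] -> `|x t| <= rho.
Proof.
move=> ab [cx _].
have cn : {within `[a, b], continuous (fun t => `|x t|)}.
  by move=> t; apply: (@cvg_norm _ _ (subspace `[a, b])); exact: cx.
by have [c _ cP] := EVT_max ab cn; exists `|x c|.
Qed.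

End Solutions.

(** * Uniqueness, continuous dependence and attraction by sinks *)

Section AutonomousFlow.
Context {R : realType} {N : nat}.
Implicit Types (G : 'rV[R]_N -> 'rV[R]_N) (x : R -> 'rV[R]_N) (p q : 'rV[R]_N).

Lemma bform1_ge p : `|p| ^+ 2 <= bform 1%:M p p.
Proof.
have b0 : 0 <= bform 1%:M p p.
  rewrite /bform mulmx1 mxE sumr_ge0// => i _.
  by rewrite mxE -expr2 sqr_ge0.
rewrite -(sqr_sqrtr b0) ler_pXn2r ?nnegrE ?sqrtr_ge0//.
apply: row_norm_le => [|i]; first exact: sqrtr_ge0.
rewrite -sqrtr_sqr ler_wsqrtr// /bform mulmx1 mxE (bigD1 i)//= mxE -expr2 lerDl.
by rewrite sumr_ge0// => j _; rewrite mxE -expr2 sqr_ge0.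
Qed.

(** This number is the dimension; it is written as the constant of [bform_norm_le] for the Euclidean
    form. *)
Definition gronwall_const : R := \sum_i \sum_j `|(1%:M : 'M[R]_N) i j|.

Lemma gronwall_const_ge0 : 0 <= gronwall_const.
Proof. by do 2 (rewrite sumr_ge0// => ? _). Qed.

(** The squared Euclidean distance is differentiable, unlike the max norm, and [growth_le] applies
    to it; passing between the two norms costs the factor [gronwall_const]. *)
Lemma gronwall (L : R) x1 x2 (d1 d2 : R -> 'rV[R]_N) (a b : R) :
  0 <= L -> a <= b ->
  {within `[a, b], continuous x1} -> {within `[a, b], continuous x2} ->
  (forall t, t \in `]a, b[ -> is_derive t (1 : R) x1 (d1 t)) ->
  (forall t, t \in `]a, b[ -> is_derive t (1 : R) x2 (d2 t)) ->
  (forall t, t \in `]a, b[ -> `|d1 t - d2 t| <= L * `|x1 t - x2 t|) ->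
  `|x1 b - x2 b| ^+ 2 <=
    gronwall_const * expR (2 * gronwall_const * L * (b - a)) *
    `|x1 a - x2 a| ^+ 2.
Proof.
set K := gronwall_const => L0 ab c1 c2 h1 h2 hd.
have K0 : 0 <= K by exact: gronwall_const_ge0.
pose z t := x1 t - x2 t; pose phi t := bform 1%:M (z t) (z t).
have cz : {within `[a, b], continuous z}.
  by move=> t; apply: (@cvgB _ _ (subspace `[a, b])); [exact: c1|exact: c2].
have cphi : {within `[a, b], continuous phi}.
  exact: (@continuous_bform R N (subspace `[a, b]) 1%:M z z cz cz).
have hphi t : t \in `]a, b[ -> is_derive t (1 : R) phi
    (bform 1%:M (d1 t - d2 t) (z t) + bform 1%:M (z t) (d1 t - d2 t)).
  move=> tab; have ? := h1 _ tab; have ? := h2 _ tab.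
  have dz : is_derive t (1 : R) z (d1 t - d2 t) by exact: is_deriveB.
  exact: is_derive_bform.
have le_phi t : t \in `]a, b[ ->
    bform 1%:M (d1 t - d2 t) (z t) + bform 1%:M (z t) (d1 t - d2 t) <=
    2 * K * L * phi t.
  move=> tab; rewrite (bform_sym (d1 t - d2 t)) ?trmx1//.
  suff : bform 1%:M (z t) (d1 t - d2 t) <= K * (L * phi t) by lra.
  rewrite (le_trans (ler_norm _))//.
  rewrite (le_trans (bform_norm_le _ _ _))// -/K -mulrA ler_wpM2l//.
  apply: le_trans (ler_wpM2l (normr_ge0 _) (hd _ tab)) _.
  rewrite mulrCA ler_wpM2l// -expr2; exact: bform1_ge.
have := growth_le ab cphi hphi le_phi => H.
apply: le_trans (bform1_ge _) _; apply: le_trans H _.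
rewrite [K * expR _]mulrC -[leRHS]mulrA ler_wpM2l ?expR_ge0//.
by rewrite (le_trans (ler_norm _))// (le_trans (bform_norm_le _ _ _))// -mulrA.
Qed.

Lemma solution_unique G x1 x2 (T : R) :
  continuously_differentiable G -> 0 <= T ->
  solution_on (fun z _ => G z) `[0, T] x1 ->
  solution_on (fun z _ => G z) `[0, T] x2 -> x1 0 = x2 0 -> x1 T = x2 T.
Proof.
move=> GC1 T0 s1 s2 e0.
have [r1 br1] := solution_on_bounded T0 s1.
have [r2 br2] := solution_on_bounded T0 s2.
have [L L0 GL] := locally_lipschitz (Num.max r1 r2) GC1.
have := gronwall (ltW L0) T0 s1.1 s2.1 (fun t => solution_on_itv s1)
  (fun t => solution_on_itv s2).
rewrite e0 subrr normr0 expr0n/= mulr0 => H.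
have /eqP : `|x1 T - x2 T| ^+ 2 = 0.
  apply/eqP; rewrite eq_le sqr_ge0 andbT; apply: H => t.
  rewrite in_itv/= => /andP[/ltW t0 /ltW tT].
  by apply: GL; rewrite le_max ?br1 ?br2 ?orbT// in_itv/= t0.
by rewrite sqrf_eq0 normr_eq0 subr_eq0 => /eqP.
Qed.

(** The truncated field has solutions for all forward time. By Gronwall those starting close enough
    to [x1 0] stay within [e] of [x1], in the ball where the truncation is inactive, so they solve
    the original equation. *)
Lemma solution_perturb G x1 (T e : R) :
  continuously_differentiable G -> 0 <= T ->
  solution_on (fun z _ => G z) `[0, T] x1 -> 0 < e ->
  exists2 d : R, 0 < d & forall p, `|p - x1 0| < d ->
    exists x, [/\ solution_on (fun z _ => G z) `[0, T] x, x 0 = p &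
      forall t, t \in `[0, T] -> `|x t - x1 t| <= e].
Proof.
move=> GC1 T0 s1 e0.
have [r br] := solution_on_bounded T0 s1.
pose rho := Num.max r 0 + e.
have r_rho : r <= rho.
  by have : r <= Num.max r 0 by [rewrite le_max lexx]; rewrite /rho; lra.
have rho0 : 0 <= rho.
  by have : 0 <= Num.max r 0 by [rewrite le_max lexx orbT]; rewrite /rho; lra.
have [L L0 GL] := locally_lipschitz rho GC1.
have GcL p q : `|G (clip rho p) - G (clip rho q)| <= L * `|p - q|.
  apply: le_trans (GL _ _ (clip_norm_le _ rho0) (clip_norm_le _ rho0)) _.
  by rewrite ler_pM2l// clip_lipschitz.
(* [B] dominates the Gronwall factor and is at least 1, so an initial distance below [e / B] gives a
   squared distance of at most [e ^+ 2 / B], hence at most [e ^+ 2]. *)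
pose B := gronwall_const * expR (2 * gronwall_const * L * T) + 1.
have B1 : 1 <= B by rewrite lerDr mulr_ge0 ?expR_ge0// gronwall_const_ge0.
have B0 : 0 < B by exact: lt_le_trans B1.
exists (e / B) => [|p pd]; first by rewrite divr_gt0.
have [x x0 dx] := lipschitz_solution p L0 GcL.
have close t : t \in `[0, T] -> `|x t - x1 t| <= e.
  rewrite in_itv/= => /andP[t0 tT].
  have sub : `[0, t]%classic `<=` `[0, T]%classic.
    by move=> s; rewrite /= !in_itv/= => /andP[-> /le_trans]; apply.
  have s1t := solution_on_subset sub s1.
  have sx : solution_on (fun z _ => G (clip rho z)) `[0, t] x.
    by apply: solution_on_derive => s; rewrite /= in_itv/= => /andP[s0 _]; exact: dx.
  have := gronwall (ltW L0) t0 sx.1 s1t.1 (fun s => solution_on_itv sx)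
    (fun s => solution_on_itv s1t).
  move=> /(_ _)/le_trans H; rewrite -(@ler_pXn2r _ 2) ?nnegrE ?(ltW e0)//.
  apply: H => [s|].
    rewrite in_itv/= => /andP[s0 st].
    rewrite -[in X in _ - X](@clip_id _ _ rho (x1 s)).
      exact: GcL.
    by apply: le_trans r_rho; apply: br; rewrite in_itv/= (ltW s0)/= (le_trans (ltW st)).
  rewrite x0 subr0.
  apply: (@le_trans _ _ (B * (e / B) ^+ 2)).
    apply: ler_pM; rewrite ?mulr_ge0 ?expR_ge0 ?gronwall_const_ge0 ?sqr_ge0//.
      rewrite /B -[leLHS]addr0 lerD// ler_wpM2l ?gronwall_const_ge0// ler_expR.
      by rewrite ler_wpM2l// !mulr_ge0 ?gronwall_const_ge0// ltW.
    by rewrite ler_pXn2r ?nnegrE// ?divr_ge0 ?(ltW pd) ?(ltW e0) ?(ltW B0).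
  have -> : B * (e / B) ^+ 2 = e ^+ 2 / B by field; rewrite gt_eqF.
  by rewrite ler_pdivrMr// ler_peMr// sqr_ge0.
exists x; split => //.
apply: solution_on_derive => t; rewrite /= => tT.
have := dx t; rewrite clip_id; first by apply; move: tT; rewrite in_itv/= => /andP[].
rewrite -(subrK (x1 t) (x t)) (le_trans (ler_normD _ _))// addrC lerD ?close//.
by rewrite le_max br.
Qed.

(** Along the flow of the displacement [z] from [y], the linear part lowers [- P] at rate at least
    [2 * c] times the squared norm, and the nonlinear remainder gives back at most half of that.
    Hence [- P] decays exponentially at rate [k]. *)
Lemma sink_attracts G (y : 'rV[R]_N) : (0 < N)%N ->
  continuously_differentiable G -> sink G y ->
  exists2 delta : R, 0 < delta &
    forall xi, `|xi| < delta -> exists x, [/\ x 0 = y + xi,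
      forall t : R, 0 <= t -> is_derive t (1 : R) x (G (x t)) &
      `|x t - y| @[t --> +oo] --> (0 : R)].
Proof.
move=> N0 GC1 [Gy eig].
set A := jacobian G y.
have [|P [PT [c c0 PA] /(_ eig)[c2 c20 Pneg]]] := @lyapunov_form R N A N0.
  by move=> z /eig/lt_eqF ->.
pose C := \sum_i \sum_j `|P i j| + 1.
have C0 : 0 < C by rewrite ltr_wpDl//; do 2 (rewrite sumr_ge0// => ? _).
have PC u w : `|bform P u w| <= C * `|u| * `|w|.
  by rewrite (le_trans (bform_norm_le _ _ _))// !ler_wpM2r// lerDl.
pose e := c / (2 * C).
have e0 : 0 < e by rewrite divr_gt0// mulr_gt0.
have [r r0 Gr] := linearization_le y GC1 e0.
pose h z := G (y + z) - z *m A.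
have hL p q : `|p| <= r -> `|q| <= r -> `|h p - h q| <= e * `|p - q|.
  move=> pr qr; have E : y + p - (y + q) = p - q.
    by rewrite opprD addrACA subrr add0r.
  have -> : h p - h q = G (y + p) - G (y + q) - (y + p - (y + q)) *m A.
    by rewrite E /h mulmxBl !opprD !opprK addrACA.
  by rewrite -E; apply: Gr; rewrite addrC addKr.
have h0 : h 0 = 0 by rewrite /h addr0 mul0mx subr0.
(* Truncating only the nonlinear part keeps the decay estimate global, so no
   exit-time argument is needed. *)
pose H z := z *m A + h (clip r z).
have SA : 0 <= \sum_i \sum_j `|A i j| by do 2 (rewrite sumr_ge0// => ? _).
pose L := \sum_i \sum_j `|A i j| + e.
have L0 : 0 < L by rewrite ltr_wpDl.
have HL p q : `|H p - H q| <= L * `|p - q|.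
  rewrite /H opprD addrACA -mulmxBl (le_trans (ler_normD _ _))// mulrDl lerD//.
    exact: mulmx_norm_le.
  apply: le_trans (hL _ _ (clip_norm_le _ (ltW r0)) (clip_norm_le _ (ltW r0))) _.
  by rewrite ler_wpM2l ?(ltW e0)// clip_lipschitz.
have hclip z : `|h (clip r z)| <= e * `|z|.
  have clip0 : clip r 0 = 0 :> 'rV[R]_N by apply: clip_id; rewrite normr0 ltW.
  have := hL (clip r z) (clip r 0) (clip_norm_le _ (ltW r0)) (clip_norm_le _ (ltW r0)).
  rewrite clip0 h0 !subr0 => /le_trans; apply; rewrite ler_wpM2l ?(ltW e0)//.
  by have := clip_lipschitz r z 0; rewrite clip0 !subr0.
(* The ratio of the upper and lower bounds of [- P] against the squared norm, increased by 1 to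
   ensure [1 <= B]. *)
pose B := C / c2 + 1.
have B1 : 1 <= B by rewrite lerDr divr_ge0// ltW.
have B0 : 0 < B by exact: lt_le_trans B1.
pose k := c / C.
have k0 : 0 < k by rewrite divr_gt0.
exists (r / B) => [|xi xid]; first by rewrite divr_gt0.
have [z z0 dz] := lipschitz_solution xi L0 HL.
have decay t : 0 <= t -> `|z t| ^+ 2 <= B * expR (- k * t) * `|xi| ^+ 2.
  move=> t0; pose V t := bform (- P) (z t) (z t).
  have dV (s : R) : 0 <= s -> is_derive s (1 : R) V
      (bform (- P) (H (z s)) (z s) + bform (- P) (z s) (H (z s))).
    by move=> s0; apply: is_derive_bform; exact: dz.
  have cV : {within `[0, t], continuous V}.
    apply: derivable_within_continuous => s; rewrite in_itv/= => /andP[s0 _].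
    by case: (dV s s0).
  have leV (s : R) : s \in `]0, t[ ->
      bform (- P) (H (z s)) (z s) + bform (- P) (z s) (H (z s)) <= - k * V s.
    move=> _; rewrite (bform_sym (H (z s))); last by rewrite linearN/= PT.
    rewrite -mulr2n -mulr_natl {1}/H bformDr /V !bformNm.
    have h1 := PA (z s).
    have h2 : - bform P (z s) (h (clip r (z s))) <= C * e * `|z s| ^+ 2.
      rewrite (le_trans (ler_norm _))// normrN (le_trans (PC _ _))//.
      apply: le_trans (ler_wpM2l _ (hclip _)) _; first by rewrite mulr_ge0// ltW.
      by rewrite le_eqVlt; apply/orP; left; apply/eqP; ring.
    have h3 : - bform P (z s) (z s) <= C * `|z s| ^+ 2.
      by rewrite (le_trans (ler_norm _))// normrN (le_trans (PC _ _))// -mulrA.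
    have Ce : C * e = c / 2 by rewrite /e; field; rewrite gt_eqF.
    have kV : - (c * `|z s| ^+ 2) <= - k * - bform P (z s) (z s).
      rewrite mulNr lerN2 /k mulrAC ler_pdivrMr// -mulrA ler_wpM2l ?(ltW c0)//.
      by rewrite mulrC.
    by move: h2; rewrite Ce => h2; lra.
  have dVi (s : R) (si : s \in `]0, t[) := dV s (ltW (proj1 (andP (si : 0 < s < t)))).
  have := growth_le t0 cV dVi leV.
  rewrite subr0 /V !bformNm z0 => Vt.
  rewrite -(ler_pM2l c20).
  have h1 : c2 * `|z t| ^+ 2 <= - bform P (z t) (z t) by rewrite lerNr Pneg.
  apply: le_trans h1 (le_trans Vt _).
  apply: (@le_trans _ _ (expR (- k * t) * (C * `|xi| ^+ 2))).
    rewrite ler_wpM2l ?expR_ge0//.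
    by rewrite (le_trans (ler_norm _))// normrN (le_trans (PC _ _))// -mulrA.
  have -> : c2 * (B * expR (- k * t) * `|xi| ^+ 2) =
      expR (- k * t) * (c2 * B * `|xi| ^+ 2) by ring.
  rewrite ler_wpM2l ?expR_ge0// ler_wpM2r ?sqr_ge0// /B mulrDr mulr1.
  by rewrite mulrCA divff ?gt_eqF// mulr1 lerDl ltW.
(* With initial displacement below [r / B], the decay estimate keeps [z] in the ball where [H]
   agrees with the translated field. *)
have xir : B * `|xi| ^+ 2 <= r ^+ 2.
  apply: (@le_trans _ _ (B * (r / B) ^+ 2)).
    rewrite ler_wpM2l ?(ltW B0)// ler_pXn2r ?nnegrE ?(ltW xid)//.
    by rewrite divr_ge0 ?(ltW r0) ?(ltW B0).
  have -> : B * (r / B) ^+ 2 = r ^+ 2 / B by field; rewrite gt_eqF.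
  by rewrite ler_pdivrMr// ler_peMr// sqr_ge0.
have zr t : 0 <= t -> `|z t| <= r.
  move=> t0; rewrite -(@ler_pXn2r _ 2) ?nnegrE ?(ltW r0)//.
  apply: le_trans (decay t t0) (le_trans _ xir).
  rewrite mulrAC ler_piMr ?mulr_ge0 ?sqr_ge0 ?(ltW B0)//.
  by rewrite -expR0 ler_expR mulNr oppr_le0 mulr_ge0// ltW.
exists (fun t => y + z t); split => [|t t0|].
- by rewrite z0.
- have -> : G (y + z t) = 0 + H (z t).
    by rewrite add0r /H clip_id ?zr// /h [RHS]addrC subrK.
  by apply: is_deriveD; exact: dz.
apply/cvgrPdist_le => eps eps0; near=> t.
have t0 : 0 <= t by near: t; exact: nbhs_pinfty_ge.
rewrite sub0r normrN normr_id [y + _]addrC addrK.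
rewrite -(@ler_pXn2r _ 2) ?nnegrE ?(ltW eps0)// (le_trans (decay t t0))//.
rewrite mulNr expRN mulrAC ler_pdivrMr ?expR_gt0// (le_trans xir)//.
(* The linear lower bound on the exponential already yields convergence. *)
apply: (@le_trans _ _ (eps ^+ 2 * (k * t))); last first.
  by rewrite ler_wpM2l ?sqr_ge0// (le_trans _ (expR_ge1Dx _))// lerDr.
rewrite mulrA mulrC -ler_pdivrMr; last by rewrite mulr_gt0 ?exprn_gt0.
by near: t; apply: nbhs_pinfty_ge; exact: num_real.
Unshelve. all: by end_near. Qed.

End AutonomousFlow.

(** * The opposite vector field *)

Section Opposite.
Context {R : realType} {V W : normedModType R}.
Implicit Types (G : V -> W) (p h : V).

Lemma diff_opp G p h : differentiable G p ->
  'd (fun z => - G z) p h = - 'd G p h.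
Proof. by move=> dG; exact: (congr1 (fun f => f h) (diffN dG)). Qed.

Lemma continuously_differentiable_opp G :
  continuously_differentiable G -> continuously_differentiable (fun z => - G z).
Proof.
move=> [dG cG]; split=> [p|p e e0]; first exact: differentiableN.
apply: filterS (cG p e e0) => q hq h.
by rewrite (diff_opp _ (dG q)) (diff_opp _ (dG p)) -opprD normrN; exact: hq.
Qed.

End Opposite.

(** * Locally attracting hyperbolic equilibria are sinks *)

Section AttractingHyperbolic.
Context {R : realType} {N : nat}.
Implicit Types (G : 'rV[R]_N -> 'rV[R]_N) (x : R -> 'rV[R]_N) (p q y : 'rV[R]_N).

Lemma jacobian_opp G y : differentiable G y ->
  jacobian (fun z => - G z) y = - jacobian G y.
Proof.
move=> dG; apply/matrixP => i j; rewrite /jacobian !mxE.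
apply: etrans (congr1 (fun w : 'rV[R]_N => w 0 j) (diff_opp _ dG)) _.
by rewrite mxE.
Qed.

Lemma solution_on_reverse G x (T : R) :
  solution_on (fun z _ => G z) `[0, T] x ->
  solution_on (fun z _ => - G z) `[0, T] (fun t => x (T - t)).
Proof.
move=> sx; have N1 : -1 != 0 :> R by rewrite oppr_eq0 oner_eq0.
have := solution_on_affine T N1 sx.
have -> : (fun t => x (-1 * t + T)) = (fun t => x (T - t)).
  by apply/funext => t; rewrite mulN1r addrC.
have -> : (fun (z : 'rV[R]_N) (t : R) => -1 *: G z) = (fun z _ => - G z).
  by apply/funext => z; apply/funext => t; rewrite scaleN1r.
apply: solution_on_subset => t; rewrite /= !in_itv/= => /andP[t0 tT].
by apply/andP; split; lra.
Qed.

(* The form [P] grows along the difference of two nearby solutions, so it cannot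
   be positive on that difference if both stay near [y] forever. *)
Lemma close_solutions_form_le0 G y (P : 'M[R]_N) (c C r a : R) x1 x2 :
  P^T = P -> 0 < c -> 0 < C ->
  (forall u w, `|bform P u w| <= C * `|u| * `|w|) ->
  (forall u, c * `|u| ^+ 2 <= bform P u (u *m jacobian G y)) ->
  (forall p q, `|p - y| <= r -> `|q - y| <= r ->
    `|G p - G q - (p - q) *m jacobian G y| <= c / (2 * C) * `|p - q|) ->
  solution_on (fun z _ => G z) `[a, +oo[ x1 ->
  solution_on (fun z _ => G z) `[a, +oo[ x2 ->
  (forall t, a <= t -> `|x1 t - y| <= r) ->
  (forall t, a <= t -> `|x2 t - y| <= r) ->
  bform P (x1 a - x2 a) (x1 a - x2 a) <= 0.
Proof.
move=> PT c0 C0 PC PA Gr s1 s2 x1r x2r.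
rewrite leNgt; apply/negP => pos.
pose z t := x1 t - x2 t; pose phi t := bform P (z t) (z t).
pose k := c / C.
have k0 : 0 < k by rewrite divr_gt0.
have r0 : 0 <= r by apply: le_trans (x1r a (lexx a)).
have growth b : a <= b -> expR (k * (b - a)) * phi a <= phi b.
  move=> ab.
  have sub : `[a, b]%classic `<=` `[a, +oo[%classic.
    by move=> s; rewrite /= !in_itv/= => /andP[->].
  have s1b := solution_on_subset sub s1; have s2b := solution_on_subset sub s2.
  have cz : {within `[a, b], continuous z}.
    by move=> t; apply: (@cvgB _ _ (subspace `[a, b])); [exact: s1b.1|exact: s2b.1].
  pose dz t := G (x1 t) - G (x2 t).
  (* Working with [- P] turns the upper estimate [growth_le] into a lower bound for the growth of
     [P]. *)
  pose psi t := bform (- P) (z t) (z t).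
  have cpsi : {within `[a, b], continuous psi}.
    exact: (@continuous_bform R N (subspace `[a, b]) (- P) z z cz cz).
  have dpsi t : t \in `]a, b[ -> is_derive t (1 : R) psi
      (bform (- P) (dz t) (z t) + bform (- P) (z t) (dz t)).
    move=> tab; have ? := solution_on_itv s1b tab; have ? := solution_on_itv s2b tab.
    have dzt : is_derive t (1 : R) z (dz t) by exact: is_deriveB.
    exact: is_derive_bform.
  have le_psi t : t \in `]a, b[ ->
      bform (- P) (dz t) (z t) + bform (- P) (z t) (dz t) <= k * psi t.
    rewrite in_itv/= => /andP[/ltW at_ _].
    rewrite (bform_sym (dz t)); last by rewrite linearN/= PT.
    rewrite /psi !bformNm.
    pose w := dz t - z t *m jacobian G y.
    have -> : dz t = z t *m jacobian G y + w by rewrite /w addrC subrK.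
    rewrite bformDr.
    have h1 := PA (z t).
    have h2 : - bform P (z t) w <= C * (c / (2 * C)) * `|z t| ^+ 2.
      rewrite (le_trans (ler_norm _))// normrN (le_trans (PC _ _))//.
      have wz : `|w| <= c / (2 * C) * `|z t| by apply: Gr; [exact: x1r|exact: x2r].
      apply: le_trans (ler_wpM2l _ wz) _; first by rewrite mulr_ge0// ltW.
      by rewrite le_eqVlt; apply/orP; left; apply/eqP; ring.
    have h3 : bform P (z t) (z t) <= C * `|z t| ^+ 2.
      by rewrite (le_trans (ler_norm _))// (le_trans (PC _ _))// -mulrA.
    have Ce : C * (c / (2 * C)) = c / 2 by field; rewrite gt_eqF.
    have kV : k * bform P (z t) (z t) <= c * `|z t| ^+ 2.
      rewrite /k mulrAC ler_pdivrMr// -mulrA ler_wpM2l ?(ltW c0)//.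
      by rewrite mulrC.
    by move: h2; rewrite Ce => h2; lra.
  have := growth_le ab cpsi dpsi le_psi.
  by rewrite /psi !bformNm mulrN lerN2.
have phi_le b : a <= b -> phi b <= C * (2 * r) ^+ 2.
  move=> ab; rewrite (le_trans (ler_norm _))// (le_trans (PC _ _))// -mulrA -expr2.
  rewrite ler_wpM2l ?(ltW C0)// ler_pXn2r ?nnegrE ?mulr_ge0//.
  rewrite /z -(subrKA y) (le_trans (ler_normD _ _))// (distrC y).
  by have := x1r _ ab; have := x2r _ ab; lra.
(* Since the exponential of [k * tau] is at least [k * tau], by time [a + tau] the form would exceed
   its bound on the ball by 1. *)
pose tau := (C * (2 * r) ^+ 2 + 1) / (k * phi a).
have num0 : 0 <= C * (2 * r) ^+ 2 by rewrite mulr_ge0 ?sqr_ge0 ?ltW.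
have tau0 : 0 <= tau by
  apply: divr_ge0; [exact: addr_ge0|apply: mulr_ge0; exact: ltW].
have atau : a <= a + tau by rewrite lerDl.
have := le_trans (growth _ atau) (phi_le _ atau).
rewrite addrAC subrr add0r => H.
have : k * tau * phi a <= C * (2 * r) ^+ 2.
  apply: le_trans H; rewrite ler_wpM2r ?(ltW pos)//.
  by rewrite (le_trans _ (expR_ge1Dx _))// lerDr.
have -> : k * tau * phi a = C * (2 * r) ^+ 2 + 1.
  by rewrite /tau; field; rewrite !gt_eqF.
lra.
Qed.

Definition eventually_close G y (rho r : R) (n : nat) : set 'rV[R]_N :=
  [set p | `|p - y| <= rho /\ exists x,
    [/\ solution_on (fun z _ => G z) `[0, +oo[ x, x 0 = p &
      forall t, n%:R <= t -> `|x t - y| <= r]].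

(** At a fixed time [t], continuous dependence on [[0, t]] brings the solution from a limit point
    within [e] of one from a point of the set; uniqueness identifies the perturbed solution with the
    witness staying near [y]. *)
Lemma eventually_close_closed G y (rho r : R) n :
  continuously_differentiable G ->
  (forall p, `|p - y| <= rho -> exists2 x,
    solution_on (fun z _ => G z) `[0, +oo[ x & x 0 = p) ->
  closed (eventually_close G y rho r n).
Proof.
move=> GC1 ex p clp.
have prho : `|p - y| <= rho.
  apply/ler_addgt0Pr => e e0.
  have [q [[qrho _]]] := clp _ (nbhsx_ballx p e e0).
  rewrite -ball_normE/= => pq; rewrite -(subrKA q) (le_trans (ler_normD _ _))//.
  by rewrite addrC lerD// ltW.
split => //; have [x1 s1 x10] := ex p prho; exists x1; split => // t nt.
apply/ler_addgt0Pr => e e0.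
have t0 : 0 <= t by apply: le_trans nt.
have sub : `[0, t]%classic `<=` `[0, +oo[%classic.
  by move=> s; rewrite /= !in_itv/= => /andP[->].
have s1t := solution_on_subset sub s1.
have [d d0 dP] := solution_perturb GC1 t0 s1t e0.
have [q [[_ [x2 [s2 x20 x2r]]]]] := clp _ (nbhsx_ballx p d d0).
rewrite -ball_normE/= distrC -x10 => /dP[x [sx x0 xx1]].
have x2x : x2 t = x t.
  by apply: (solution_unique GC1 t0 (solution_on_subset sub s2) sx); rewrite x20.
have := xx1 t; rewrite in_itv/= t0 lexx => /(_ isT).
rewrite -x2x distrC => H.
rewrite -(subrKA (x2 t)) (le_trans (ler_normD _ _))//.
by rewrite addrC lerD// x2r.
Qed.

Lemma Baire_rV (F : (set 'rV[R]_N)^nat) :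
  (forall i, open (F i) /\ dense (F i)) -> dense (\bigcap_i (F i)).
Proof.
pose U : completeNormedModType R := HB.pack 'rV[R]_N
  (Uniform_isComplete.Build 'rV[R]_N (@cauchy_cvg _)).
exact: (@Baire R U).
Qed.

Lemma attracting_sink G y (delta : R) : (0 < N)%N ->
  continuously_differentiable G -> hyperbolic_equilibrium G y -> 0 < delta ->
  (forall xi, `|xi| < delta -> exists x,
    [/\ solution_on (fun z _ => G z) `[0, +oo[ x, x 0 = y + xi &
      `|x s - y| @[s --> +oo] --> (0 : R)]) ->
  sink G y.
Proof.
move=> N0 GC1 [Gy hyp] delta0 attr; split => //.
have [P [PT [c c0 PA] _]] := lyapunov_form N0 hyp.
apply: (lyapunov_form_stable PT c0 PA) => u0; rewrite leNgt; apply/negP => pos.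
pose C := \sum_i \sum_j `|P i j| + 1.
have C0 : 0 < C by rewrite ltr_wpDl//; do 2 (rewrite sumr_ge0// => ? _).
have PC u w : `|bform P u w| <= C * `|u| * `|w|.
  by rewrite (le_trans (bform_norm_le _ _ _))// !ler_wpM2r// lerDl.
have e0 : 0 < c / (2 * C) by rewrite divr_gt0// mulr_gt0.
have [r r0 Gr] := linearization_le y GC1 e0.
(* Halving [delta] provides a closed ball of initial points that are all attracted. *)
pose rho := delta / 2.
have rho0 : 0 < rho by rewrite divr_gt0.
have attr' p : `|p - y| <= rho -> exists x,
    [/\ solution_on (fun z _ => G z) `[0, +oo[ x, x 0 = p &
      `|x s - y| @[s --> +oo] --> (0 : R)].
  move=> py; have [|x [sx x0 cx]] := attr (p - y).
    by rewrite (le_lt_trans py)// /rho; lra.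
  by exists x; split => //; rewrite x0 addrC subrK.
pose E n := eventually_close G y rho r n.
have Ecl n : closed (E n).
  by apply: eventually_close_closed => // p /attr'[x [sx x0 _]]; exists x.
(* Otherwise the complements of the [E n] are open and dense, and by Baire some point of the ball
   lies in none of the [E n], although its trajectory converges to [y]. *)
have [n [U U0 [oU UE]]] : exists n, exists2 U, U !=set0 & open U /\ U `<=` E n.
  apply: contrapT => noU.
  have dense_n n : dense (~` E n).
    move=> U U0 oU; apply: contrapT => UE; apply: noU.
    exists n, U => //; split => // q Uq; apply: contrapT => nEq.
    by apply: UE; exists q.
  have := @Baire_rV (fun n => ~` E n)
    (fun n => conj (closed_openC (Ecl n)) (dense_n n)).
  move=> /(_ (ball y rho)) [||q [qy qE]].
  - by exists y; exact: ballxx.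
  - exact: ball_open.
  have {}qy : `|q - y| <= rho by move: qy; rewrite -ball_normE/= distrC => /ltW.
  have [x [sx x0 /cvgrPdist_le/(_ r r0)[M [Mreal xM]]]] := attr' q qy.
  have [n nM] : exists n : nat, M < n%:R.
    by exists (Num.truncn `|M|).+1; rewrite (le_lt_trans (ler_norm _))// truncnS_gt.
  apply: (qE n I); split => //; exists x; split => // t nt.
  have := xM t (lt_le_trans nM nt).
  by rewrite sub0r normrN normr_id.
have [p Up] := U0.
have [_ [x1 [s1 x10 x1r]]] := UE p Up.
have [eta eta0 Ueta] : exists2 eta : R, 0 < eta & ball p eta `<=` U.
  by have /nbhs_ballP[eta /= eta0 ?] := open_nbhs_nbhs (conj oU Up); exists eta.
have n0 : 0 <= n%:R :> R by [].
have sub : `[0, n%:R : R]%classic `<=` `[0, +oo[%classic.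
  by move=> s; rewrite /= !in_itv/= => /andP[->].
(* The time-[n] map is inverted locally by flowing backwards: solutions of the opposite field
   starting near [x1 n%:R] end within [eta / 2] of [p], hence in [U]. *)
have rev1 := solution_on_reverse (solution_on_subset sub s1).
have eta20 : 0 < eta / 2 by rewrite divr_gt0.
have [d d0 dP] := solution_perturb (continuously_differentiable_opp GC1) n0 rev1 eta20.
(* Scaled so that [s *: u0] is shorter than [d], also when [u0] is large; the sign of the form is
   unaffected by scaling. *)
pose s := d / (2 * (`|u0| + 1)).
have s0 : 0 < s by rewrite divr_gt0// mulr_gt0// ltr_wpDl.
have [|psi [spsi psi0 psir]] := dP (x1 n%:R + s *: u0).
  rewrite subr0 addrC addKr normrZ gtr0_norm// /s mulrAC.
  rewrite ltr_pdivrMr; last by rewrite mulr_gt0// ltr_wpDl.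
  by rewrite ltr_pM2l//; have := normr_ge0 u0; lra.
have [_ [x2 [s2 x20 x2r]]] : E n (psi n%:R).
  apply/UE/Ueta; rewrite -ball_normE/= distrC -x10.
  have := psir n%:R; rewrite in_itv/= n0 lexx subrr => /(_ isT)/le_lt_trans; apply.
  by lra.
(* By uniqueness the trajectory from [psi n%:R] retraces [psi], so at time [n] it differs from [x1]
   exactly by [s *: u0]. *)
have x2n : x2 n%:R = x1 n%:R + s *: u0.
  have rev2 := solution_on_reverse spsi.
  have -> : x1 n%:R + s *: u0 = psi (n%:R - n%:R) by rewrite subrr psi0.
  apply: (@solution_unique _ _ G x2 (fun t => psi (n%:R - t)) n%:R GC1 n0
    (solution_on_subset sub s2)).
    move: rev2; rewrite (_ : (fun z _ => - - G z) = (fun z _ => G z))//.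
    by apply/funext => z; apply/funext => ?; rewrite opprK.
  by rewrite x20 subr0.
have subn : `[n%:R : R, +oo[%classic `<=` `[0, +oo[%classic.
  by move=> t; rewrite /= !in_itv/= !andbT; exact: le_trans.
have := close_solutions_form_le0 PT c0 C0 PC PA Gr (solution_on_subset subn s2)
  (solution_on_subset subn s1) x2r x1r.
rewrite x2n [x1 _ + _]addrC addrK bformZl bformZr leNgt => /negP; apply.
by rewrite !mulr_gt0.
Qed.

End AttractingHyperbolic.

(** Intended for affine embeddings [i]: the differential [di] is the same at every point and does
    not increase norms, so the modulus for [f] carries over unchanged. *)
Lemma continuously_differentiable_comp (R : realType)
    (U V W : normedModType R) (i di : U -> V) (f : V -> W) (d : W) :
  (forall p, is_diff p i di) -> (forall h, `|di h| <= `|h|) ->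
  continuously_differentiable f ->
  continuously_differentiable (fun p => f (i p) - d).
Proof.
move=> idi di1 [df cf].
have dfi p : is_diff p (fun p => f (i p) - d) ('d f (i p) \o di).
  have ? := differentiableP (df (i p)).
  have ? : is_diff p (f \o i) ('d f (i p) \o di) by exact: is_diff_comp.
  have ? : is_diff p (fun p => f (i p)) ('d f (i p) \o di) by [].
  by apply: is_diff_eq; rewrite subr0.
split=> [p|p e e0]; first by case: (dfi p).
have ci : {for p, continuous i}.
  by have [/differentiable_continuous] := idi p.
have near_p : \forall q \near p, forall h,
    `|'d f (i q) h - 'd f (i p) h| <= e * `|h| := ci _ (cf (i p) e e0).
apply: filterS near_p => q hq h.
have [_ ->] := dfi q; have [_ ->] := dfi p => /=.
by apply: le_trans (hq (di h)) _; rewrite ler_wpM2l// ltW.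
Qed.

(** * Changes of variable in limits at infinity *)

Section Tails.
Context {R : realType} {T : topologicalType}.
Implicit Types (h : R -> T) (l : T) (c : R).

Lemma cvg_pinfty_subr h l c :
  h s @[s --> +oo] --> l -> h (s - c) @[s --> +oo] --> l.
Proof.
move=> hl A /hl[M [_ hM]]; exists (M + c); split; first exact: num_real.
by move=> s Ms; apply: hM; rewrite ltrBrDr.
Qed.

Lemma cvg_pinfty_subl h l c :
  h s @[s --> +oo] --> l -> h (c - s) @[s --> -oo] --> l.
Proof.
move=> hl A /hl[M [_ hM]]; exists (c - M); split; first exact: num_real.
by move=> s Ms; apply: hM; rewrite ltrBrDl addrC -ltrBrDl.
Qed.

Lemma cvg_ninfty_opp h l :
  h s @[s --> -oo] --> l -> h (- s) @[s --> +oo] --> l.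
Proof.
move=> hl A /hl[M [_ hM]]; exists (- M); split; first exact: num_real.
by move=> s Ms; apply: hM; rewrite ltrNl.
Qed.

End Tails.

(** * Spectrum and equilibria under time reversal *)

Section TimeReversal.
Context {R : realType} {N : nat}.
Implicit Types (G : 'rV[R]_N -> 'rV[R]_N) (y : 'rV[R]_N).

Lemma linearization_eigenvalue_opp G y (z : R[i]) : differentiable G y ->
  linearization_eigenvalue (fun w => - G w) y z <->
  linearization_eigenvalue G y (- z).
Proof.
move=> dG; apply: (@eq_ind_r _ _ (fun J : 'M[R]_N =>
  eigenvalue (map_mx (real_complex R) J) z <-> _) _ _ (jacobian_opp dG)).
rewrite map_mxN /linearization_eigenvalue.
split=> /eigenvalueP[w wJ w0]; apply/eigenvalueP; exists w => //.
  by rewrite scaleNr -wJ mulmxN opprK.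
by rewrite mulmxN wJ scaleNr opprK.
Qed.

Lemma hyperbolic_equilibrium_opp G y : differentiable G y ->
  hyperbolic_equilibrium G y -> hyperbolic_equilibrium (fun w => - G w) y.
Proof.
move=> dG [Gy hyp]; split=> [|z /(iffLR (linearization_eigenvalue_opp z dG))/hyp].
  by rewrite /equilibrium Gy oppr0.
by case: z => a b; rewrite /= oppr_eq0.
Qed.

Lemma sink_opp G y : differentiable G y ->
  sink (fun w => - G w) y <-> source G y.
Proof.
move=> dG; split=> -[Gy eig]; split.
- by apply/eqP; rewrite -oppr_eq0; apply/eqP.
- move=> z zG; rewrite -oppr_lt0.
  have /eig : linearization_eigenvalue (fun w => - G w) y (- z).
    by apply/(iffRL (linearization_eigenvalue_opp _ dG)); rewrite opprK.
  by case: z {zG}.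
- by rewrite /equilibrium Gy oppr0.
- move=> z /(iffLR (linearization_eigenvalue_opp z dG))/eig.
  by case: z => a b /=; rewrite oppr_gt0.
Qed.

End TimeReversal.

(** * Transfer between the moving frame and the nonautonomous system *)

Section MovingFrame.
Context {R : realType} {N : nat}.
Variables (F : 'rV[R]_N -> R -> 'rV[R]_N) (G : 'rV[R]_N -> 'rV[R]_N).
Variables (v dv : R -> 'rV[R]_N).
Hypothesis v_derive : forall t : R, is_derive t (1 : R) v (dv t).
Hypothesis F_G : forall z t, F (z + v t) t = G z + dv t.
Implicit Types (I : set R) (x u : R -> 'rV[R]_N) (y : 'rV[R]_N).

Let v_cont I : {within I, continuous v}.
Proof.
apply: continuous_subspaceT => t.
by have [/derivable1_diffP/differentiable_continuous] := v_derive t.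
Qed.

Lemma solution_on_add I u :
  solution_on (fun z _ => G z) I u -> solution_on F I (fun t => u t + v t).
Proof.
move=> [cu du]; split=> [t|t It].
  by apply: (@cvgD _ _ (subspace I)); [exact: cu|exact: v_cont].
by rewrite F_G; apply: is_deriveD; exact: du.
Qed.

Lemma solution_on_sub I x :
  solution_on F I x -> solution_on (fun z _ => G z) I (fun t => x t - v t).
Proof.
move=> [cx dx]; split=> [t|t It].
  by apply: (@cvgB _ _ (subspace I)); [exact: cx|exact: v_cont].
have -> : G (x t - v t) = F (x t) t - dv t.
  by rewrite -{2}(subrK (v t) (x t)) F_G addrK.
by apply: is_deriveB; exact: dx.
Qed.

Hypotheses (N_gt0 : (0 < N)%N) (G_C1 : continuously_differentiable G).

Let in_frame (u y : 'rV[R]_N) t : `|u + v t - (y + v t)| = `|u - y|.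
Proof. by rewrite opprD addrACA subrr addr0. Qed.

(** In the moving frame only elapsed time matters, so one solution [u] of the autonomous equation,
    shifted in time, serves both notions: [t - s] tends to infinity as [t] goes to plus infinity or
    as the starting time [s] goes to minus infinity. Conversely, forward attraction from time [0] is
    the attraction required by [attracting_sink]. *)
Lemma sink_moving_frame y : hyperbolic_equilibrium G y ->
  sink G y <-> forward_attracting F (fun t => y + v t) /\
               pullback_attractor F (fun t => y + v t).
Proof.
move=> hyp; split=> [/(sink_attracts N_gt0 G_C1)[d d0 attr]|[[d d0 attr] _]].
  have shift u (c : R) : (forall t : R, 0 <= t -> is_derive t (1 : R) u (G (u t))) ->
      solution_on F `[c, +oo[ (fun t => u (t - c) + v t).
    move=> du; apply: solution_on_add.
    have su : solution_on (fun z _ => G z) `[0, +oo[ u.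
      by apply: solution_on_derive => t; rewrite /= in_itv/= andbT; exact: du.
    have := solution_on_affine (- c) (oner_neq0 R) su.
    have -> : (fun t => u (1 * t - c)) = (fun t => u (t - c)).
      by apply/funext => t; rewrite mul1r.
    have -> : (fun (z : 'rV[R]_N) (t : R) => 1 *: G z) = (fun z _ => G z).
      by apply/funext => z; apply/funext => t; rewrite scale1r.
    apply: solution_on_subset => t; rewrite /= !in_itv/= !andbT mul1r.
    by rewrite subr_ge0.
  split; exists d => // xi /attr[u [u0 du cu]] t0.
    exists (fun t => u (t - t0) + v t).
      by split; [exact: shift|rewrite subrr u0 addrAC].
    under eq_fun do rewrite in_frame.
    exact: (cvg_pinfty_subr t0 cu).
  exists (fun s t => u (t - s) + v t).
    move=> s st; split; last by rewrite subrr u0 addrAC.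
    apply: solution_on_subset (shift u s du) => t.
    by rewrite /= !in_itv/= => /andP[->].
  under eq_fun do rewrite in_frame.
  exact: (cvg_pinfty_subl t0 cu).
apply: (attracting_sink N_gt0 G_C1 hyp d0) => xi /attr/(_ 0)[x [sx x0] cx].
exists (fun t => x t - v t); split; first exact: solution_on_sub.
  by rewrite x0 addrAC addrK.
move: cx; rewrite (_ : (fun s => `|x s - (y + v s)|) = (fun s => `|x s - v s - y|))//.
by apply/funext => s; rewrite opprD addrCA addrC -addrA.
Qed.

Lemma source_moving_frame y : hyperbolic_equilibrium G y ->
  source G y <-> forward_repelling F (fun t => y + v t) /\
                 pullback_repeller F (fun t => y + v t).
Proof.
have dG p : differentiable G p by case: G_C1.
have G_C1' := continuously_differentiable_opp G_C1.
move=> hyp; rewrite -(sink_opp (dG y)).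
split=> [/(sink_attracts N_gt0 G_C1')[d d0 attr]|[[d d0 attr] _]].
  have shift u (c : R) : (forall t : R, 0 <= t -> is_derive t (1 : R) u (- G (u t))) ->
      solution_on F `]-oo, c] (fun t => u (c - t) + v t).
    move=> du; apply: solution_on_add.
    have su : solution_on (fun z _ => - G z) `[0, +oo[ u.
      by apply: solution_on_derive => t; rewrite /= in_itv/= andbT; exact: du.
    have N1 : -1 != 0 :> R by rewrite oppr_eq0 oner_eq0.
    have := solution_on_affine c N1 su.
    have -> : (fun t => u (-1 * t + c)) = (fun t => u (c - t)).
      by apply/funext => t; rewrite mulN1r addrC.
    have -> : (fun (z : 'rV[R]_N) (t : R) => -1 *: - G z) = (fun z _ => G z).
      by apply/funext => z; apply/funext => t; rewrite scaleN1r opprK.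
    apply: solution_on_subset => t; rewrite /= !in_itv/= andbT mulN1r addrC.
    by rewrite subr_ge0.
  split; exists d => // xi /attr[u [u0 du cu]] t0.
    exists (fun t => u (t0 - t) + v t).
      by split; [exact: shift|rewrite subrr u0 addrAC].
    under eq_fun do rewrite in_frame.
    exact: (cvg_pinfty_subl t0 cu).
  exists (fun s t => u (s - t) + v t).
    move=> s st; split; last by rewrite subrr u0 addrAC.
    apply: solution_on_subset (shift u s du) => t.
    by rewrite /= !in_itv/= => /andP[_ ->].
  under eq_fun do rewrite in_frame.
  exact: (cvg_pinfty_subr t0 cu).
apply: (attracting_sink N_gt0 G_C1' (hyperbolic_equilibrium_opp (dG y) hyp) d0).
move=> xi /attr/(_ 0)[x [sx x0] cx].
(* Leaving the frame and reversing time turns a backward solution into a forward solution of the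
   opposite field. *)
exists (fun t => x (- t) - v (- t)); split.
- have N1 : -1 != 0 :> R by rewrite oppr_eq0 oner_eq0.
  have := solution_on_affine 0 N1 (solution_on_sub sx).
  have -> : (fun t => x (-1 * t + 0) - v (-1 * t + 0)) = (fun t => x (- t) - v (- t)).
    by apply/funext => t; rewrite mulN1r addr0.
  have -> : (fun (z : 'rV[R]_N) (t : R) => -1 *: G z) = (fun z _ => - G z).
    by apply/funext => z; apply/funext => t; rewrite scaleN1r.
  apply: solution_on_subset => t; rewrite /= !in_itv/= andbT mulN1r addr0.
  by rewrite oppr_le0.
- by rewrite oppr0 x0 addrAC addrK.
have := cvg_ninfty_opp cx.
rewrite (_ : (fun s => `|x (- s) - (y + v (- s))|) =
  (fun s => `|x (- s) - v (- s) - y|))//.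
by apply/funext => s; rewrite opprD addrCA addrC -addrA.
Qed.

End MovingFrame.

(** * Regularity of the autonomous field and application to (S) *)

Section Autonomous.
Context {R : realType} {N M : nat}.

Lemma continuously_differentiable_slice
    (f : 'rV[R]_N * R * 'rV[R]_M * R -> 'rV[R]_N)
    (c d : 'rV[R]_N) (t : R) (mu : 'rV[R]_M) (r : R) :
  continuously_differentiable f ->
  continuously_differentiable (fun z => f (z + c, t, mu, r) - d).
Proof.
move=> f_C1.
pose emb (z : 'rV[R]_N) : 'rV[R]_N * R * 'rV[R]_M * R := (z + c, t, mu, r).
pose demb (h : 'rV[R]_N) : 'rV[R]_N * R * 'rV[R]_M * R := (h, 0, 0, 0).
have emb_diff z : is_diff z emb demb.
  have ? : is_diff z (fun z : 'rV[R]_N => z + c) id.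
    by apply: is_diff_eq; rewrite addr0.
  exact: is_diff_eq.
apply: (continuously_differentiable_comp _ emb_diff) => // h.
by rewrite /demb !prod_normE/= !normr0 !ge_max lexx normr_ge0.
Qed.

End Autonomous.

Theorem proposition2 (R : realType) (N M : nat) (hN : (1 <= N)%N) (hM : (1 <= M)%N)
    (f : 'rV[R]_N * R * 'rV[R]_M * R -> 'rV[R]_N)
    (a : 'I_N -> R) (lambda : R -> R)
    (g : 'rV[R]_N -> 'rV[R]_M -> R -> 'rV[R]_N)
    (mu : 'rV[R]_M) (r : R) (v : R -> 'rV[R]_N)
    (f_C1 : continuously_differentiable f)
    (lambda_C1 : continuously_differentiable lambda)
    (lambda_bounded : forall r' t1 t2 : R,
       [bounded lambda (r' * t) | t in `[t1, t2]])
    (v_shape : exists (NN : {set 'I_N}) (alpha b : 'I_N -> R), forall t : R,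
       v t = \row_i (if i \in NN then alpha i * lambda (r * t) + b i else 0))
    (autonomous : forall (y : 'rV[R]_N) (t : R),
       g y mu r = f (y + v t - Lambda a lambda (r * t), t, mu, r) - derive1 v t) :
  forall y : 'rV[R]_N,
    hyperbolic_equilibrium (fun z => g z mu r) y ->
    let S := system_S f a lambda mu r in
    let xstar := fun t : R => y + v t in
    [/\ global_solution S xstar,
        sink (fun z => g z mu r) y <->
          forward_attracting S xstar /\ pullback_attractor S xstar
      & source (fun z => g z mu r) y <->
          forward_repelling S xstar /\ pullback_repeller S xstar].
Proof.
move=> y hyp S xstar.
(* The term [derive1 v t] is a genuine derivative only once [v] is known to be differentiable, which
   follows from its shape and the regularity of [lambda]. *)
have v_derive (t : R) : is_derive t (1 : R) v (derive1 v t).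
  rewrite derive1E; apply: derivableP; apply/derivable_mxP => i j; rewrite ord1.
  have [NN [alpha [b vE]]] := v_shape.
  have dl : is_derive t (1 : R) (fun s : R => lambda (r * s)) ('d lambda (r * t) r).
    apply: is_derive_comp_diff; last by case: lambda_C1.
    have -> : ( *%R r) = r \*: (id : R -> R) by [].
    by apply: is_derive_eq; rewrite /GRing.scale/= mulr1.
  have -> : (fun s => v s 0 j) =
      (fun s => if j \in NN then alpha j * lambda (r * s) + b j else 0).
    by apply/funext => s; rewrite vE mxE.
  case: (j \in NN); last exact: derivable_cst.
  apply: derivableD; last exact: derivable_cst.
  by apply: (@derivableZ _ _ _ (fun s => lambda (r * s))); case: dl.
have S_g z t : S (z + v t) t = g z mu r + derive1 v t.
  by rewrite (autonomous z t) subrK.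
(* Evaluating the autonomous identity at time [0] exhibits [g] as a translated slice of [f], from
   which it inherits its regularity. *)
have g_C1 : continuously_differentiable (fun z => g z mu r).
  rewrite (_ : (fun z => _) = fun z =>
    f (z + (v 0 - Lambda a lambda (r * 0)), 0, mu, r) - derive1 v 0).
    exact: continuously_differentiable_slice.
  by apply/funext => z; rewrite (autonomous z 0) addrA.
split.
- apply: (solution_on_add v_derive S_g (u := fun=> y)).
  apply: solution_on_derive => t _; rewrite (proj1 hyp : g y mu r = 0).
  exact: is_derive_cst.
- exact: (sink_moving_frame v_derive S_g).
- exact: (source_moving_frame v_derive S_g).
Qed.
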